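(* For every integer $n\ge 1$, $\dim \mathcal{M}_{[n]}=\frac{n(n-1)}{2}$ and $\dim \mathcal{X}_{[n]}=\frac{(n+2)(n-1)}{2}$.
   Context: Dimension: $\dim$ is the covering dimension. A family $\mathcal{U}$ of subsets of a space $X$ has order at most $k$ if every point of $X$ lies in at most $k+1$ distinct elements of $\mathcal{U}$. For a metric space $X$ and an integer $k\ge 0$, $\dim X\le k$ means that every open cover of $X$ has an open refinement that covers $X$ and has order at most $k$; $\dim X=k$ means that $k$ is the least such integer, and $\dim X=\infty$ if there is none. Distortion: for metric spaces $(X,d_X)$, $(Y,d_Y)$ and a relation $R\subset X\times Y$, $\operatorname{dis} R=\sup\{|d_X(x_1,x_2)-d_Y(y_1,y_2)| : (x_1,y_1),(x_2,y_2)\in R\}$ (with $\operatorname{dis}\emptyset=0$). Gromov-Hausdorff space: a correspondence between $X$ and $Y$ is a relation $R\subset X\times Y$ whose projections to $X$ and to $Y$ are both surjective. The Gromov-Hausdorff distance is $d_{GH}(X,Y)=\frac12\inf_R \operatorname{dis} R$, the infimum over all correspondences $R$ between $X$ and $Y$. $\mathcal{M}$ is the metric space of isometry classes of non-empty compact metric spaces with the metric $d_{GH}$, and $\mathcal{M}_{[n]}$ is the metric subspace of isometry classes of metric spaces with precisely $n$ points. Box metric space: a metric measure space $(X,d_X,\mu_X)$ is a complete separable metric space $(X,d_X)$ with a Borel probability measure $\mu_X$; one always assumes $X=\operatorname{supp}\mu_X$. Two metric measure spaces are mm-isomorphic if there is an isometry $f\colon \operatorname{supp}\mu_X\to\operatorname{supp}\mu_Y$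 (onto) with $f_*\mu_X=\mu_Y$. $\Pi(\mu_X,\mu_Y)$ is the set of couplings, i.e. Borel measures on $X\times Y$ with marginals $\mu_X$ and $\mu_Y$. The box distance is $\square(X,Y)=\min_{\pi\in\Pi(\mu_X,\mu_Y)}\min_{S}\max\{1-\pi(S),\operatorname{dis}S\}$, where $S$ ranges over all closed subsets of $X\times Y$. $\mathcal{X}$ is the metric space of mm-isomorphism classes of metric measure spaces with the metric $\square$, and $\mathcal{X}_{[n]}$ is the metric subspace of classes of metric measure spaces with precisely $n$ points (i.e. whose support has precisely $n$ points). *)

(* Defs.v *)
From HB Require Import structures.
From mathcomp Require Import all_boot all_order all_algebra generic_quotient.
From mathcomp Require Import all_classical all_reals all_analysis.

Set Implicit Arguments.
Unset Strict Implicit.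
Unset Printing Implicit Defensive.

Import Order.TTheory GRing.Theory Num.Theory.
Local Open Scope classical_set_scope.
Local Open Scope card_scope.
Local Open Scope ring_scope.
Local Open Scope quotient_scope.

Section covering_dimension.
Variable T : topologicalType.
Implicit Types U V : set (set T).

Definition open_cover U := U `<=` open /\ \bigcup_(A in U) A = setT.

Definition refines V U := forall B, V B -> exists2 A, U A & B `<=` A.

Definition order_le U (k : nat) :=
  forall x : T, [set A | U A /\ A x] #<= `I_k.+1.

Definition dim_le (k : nat) := forall U, open_cover U ->
  exists V, [/\ open_cover V, refines V U & order_le V k].

Definition dim_eq (k : nat) :=
  dim_le k /\ forall j : nat, dim_le j -> (k <= j)%N.

End covering_dimension.

(* [dist_space d] is [T] with the topology in which a set is open iff it
   contains, around each of its points, a [d]-ball of positive radius. *)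
Definition dist_space (R : realType) (T : Type) (d : T -> T -> R) : Type := T.

Section dist_space_topology.
Variables (R : realType) (T : Type) (d : T -> T -> R).

HB.instance Definition _ := gen_eqMixin (dist_space d).
HB.instance Definition _ := gen_choiceMixin (dist_space d).

Definition dist_open : set_system (dist_space d) :=
  [set U | forall x, U x -> exists2 e : R, 0 < e & [set y | d x y < e] `<=` U].

Let dist_openT : dist_open setT.
Proof. by move=> x _; exists 1. Qed.

Let dist_openI : setI_closed dist_open.
Proof.
move=> U V oU oV x [/oU[a a0 aU] /oV[b b0 bV]].
exists (Num.min a b); first by rewrite lt_min a0 b0.
by move=> y /=; rewrite lt_min => /andP[/aU Uy /bV Vy].
Qed.

Let dist_open_bigU (I : Type) (f : I -> set (dist_space d)) :
  (forall i, dist_open (f i)) -> dist_open (\bigcup_i f i).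
Proof.
move=> of_ x [i _ /of_[e e0 ef]].
by exists e => // y /ef fy; exists i.
Qed.

HB.instance Definition _ := isOpenTopological.Build (dist_space d)
  dist_openT dist_openI dist_open_bigU.

End dist_space_topology.

(* Non-empty metric spaces. The point only witnesses non-emptiness, in the form
   required by [measurableType]; isometries are not asked to preserve it.
   The carrier is a bare [Type] with a metric structure on it, rather than an
   element of [metricType R], so that the types of isometry classes below, which
   live one universe up, can still carry topological or metric structures. *)
Record neMetric (R : realType) := NeMetric {
  ne_sort :> Type;
  ne_class : Metric R ne_sort;
  ne_point : ne_sort }.

HB.instance Definition _ (R : realType) (X : neMetric R) :=
  Metric.copy (ne_sort X) (Metric.Pack (ne_class X)).
HB.instance Definition _ (R : realType) (X : neMetric R) :=
  isPointed.Build (ne_sort X) (ne_point X).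

Section metric_notions.
Variable R : realType.
Implicit Types X Y : neMetric R.

Definition is_isometry X Y (f : X -> Y) :=
  (forall y, exists x, f x = y) /\
  (forall x1 x2, mdist (f x1) (f x2) = mdist x1 x2).

Definition has_points X (n : nat) : Prop := [set: X] #= `I_n.

(* Distances are nonnegative, so adding 0 to the set only affects the case of
   the empty relation, whose distortion is 0. *)
Definition distortion X Y (S : set (X * Y)) : \bar R :=
  ereal_sup (0%E |`
    [set (`|mdist p.1 q.1 - mdist p.2 q.2|)%:E | p in S & q in S]).

Definition correspondence X Y (S : set (X * Y)) :=
  (forall x, exists y, S (x, y)) /\ (forall y, exists x, S (x, y)).

Definition GH_dist X Y : R :=
  2^-1 * fine (ereal_inf [set distortion S | S in @correspondence X Y]).

End metric_notions.

Section GH_space.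
Variable R : realType.

Record compactMetric := CompactMetric {
  cm_space :> neMetric R;
  cm_compact : compact [set: cm_space] }.

HB.instance Definition _ := gen_eqMixin compactMetric.
HB.instance Definition _ := gen_choiceMixin compactMetric.

Definition isometric : rel compactMetric :=
  fun X Y => `[< exists f : X -> Y, is_isometry f >].

Lemma isometric_refl : reflexive isometric.
Proof. by move=> X; apply/asboolP; exists id; split=> // y; exists y. Qed.

Lemma isometric_sym : symmetric isometric.
Proof.
suff imp X Y : isometric X Y -> isometric Y X.
  by move=> X Y; apply/idP/idP; exact: imp.
move=> /asboolP[f [fs fi]]; apply/asboolP.
have [g gK] := choice fs; exists g; split=> [x|y1 y2].
  by exists (f x); apply: mdist_positivity; rewrite -fi gK mdistxx.
by rewrite -fi !gK.
Qed.

Lemma isometric_trans : transitive isometric.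
Proof.
move=> Y X Z /asboolP[f [fs fi]] /asboolP[g [gs gi]]; apply/asboolP.
exists (g \o f); split=> [z|x1 x2]; last by rewrite /= gi fi.
by have [y <-] := gs z; have [x <-] := fs y; exists x.
Qed.

Canonical isometric_equiv :=
  EquivRel isometric isometric_refl isometric_sym isometric_trans.

Definition GH_class := {eq_quot isometric_equiv}.

Definition GH_class_dist (c1 c2 : GH_class) : R := GH_dist (repr c1) (repr c2).

Definition GH_points (n : nat) : set GH_class :=
  [set c | has_points (repr c : compactMetric) n].

Definition GH_subspace (n : nat) : topologicalType :=
  dist_space (fun x y : GH_points n => GH_class_dist (val x) (val y)).

End GH_space.

(* Products of [ptopologicalType]s lack the join instance needed by [borel]. *)
HB.instance Definition _ (X Y : ptopologicalType) :=
  Topological.on (X * Y)%type.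

Section mm_spaces.
Variable R : realType.

Definition borel (T : ptopologicalType) := g_sigma_algebraType (@open T).

Definition separable (T : topologicalType) :=
  exists2 D : set T, countable D & dense D.

Definition complete_space (T : puniformType) :=
  forall F : set_system T, ProperFilter F -> cauchy F -> cvg F.

Definition support (T : ptopologicalType) (mu : set (borel T) -> \bar R) :=
  [set x : T | forall U : set T, open U -> U x -> (0 < mu U)%E].

Lemma isometry_borel (X Y : neMetric R) (f : X -> Y) (A : set (borel Y)) :
  is_isometry f -> measurable A -> measurable (f @^-1` A : set (borel X)).
Proof.
move=> [_ fi] mA.
have cf : continuous (f : X -> Y).
  move=> x; apply/cvg_ballP => e e0; near=> y.
  have : ball x e y by near: y; exact: nbhsx_ballx.
  by rewrite !ballEmdist/= fi.
have mf : measurable_fun setT (f : borel X -> borel Y).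
  apply: (measurability (@open Y : set (set (borel Y)))) => // _ [U oU <-].
  by rewrite setTI; apply: sub_sigma_algebra; exact: open_comp.
by rewrite -[X in measurable X]setTI; exact: mf measurableT _ mA.
Unshelve. all: by end_near. Qed.

Record mmSpace := MMSpace {
  mm_space :> neMetric R;
  mm_complete : complete_space mm_space;
  mm_separable : separable mm_space;
  mm_measure : probability (borel mm_space) R;
  mm_support : support mm_measure = [set: mm_space] }.

HB.instance Definition _ := gen_eqMixin mmSpace.
HB.instance Definition _ := gen_choiceMixin mmSpace.

(* The supports are the whole spaces, so [f] is defined on and valued in
   the spaces themselves. *)
Definition mm_isometry (X Y : mmSpace) (f : X -> Y) :=
  is_isometry f /\
  forall A : set (borel Y), measurable A ->
    mm_measure X (f @^-1` A) = mm_measure Y A.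

Definition mm_isomorphic : rel mmSpace :=
  fun X Y => `[< exists f : X -> Y, mm_isometry f >].

Lemma mm_isomorphic_refl : reflexive mm_isomorphic.
Proof.
by move=> X; apply/asboolP; exists id; split=> //; split=> // y; exists y.
Qed.

Lemma mm_isomorphic_sym : symmetric mm_isomorphic.
Proof.
suff imp X Y : mm_isomorphic X Y -> mm_isomorphic Y X.
  by move=> X Y; apply/idP/idP; exact: imp.
move=> /asboolP[f [[fs fi] fmu]]; apply/asboolP.
have [g gK] := choice fs.
have fK x : g (f x) = x by apply: mdist_positivity; rewrite -fi gK mdistxx.
have gi : is_isometry g.
  by split=> [x|y1 y2]; [exists (f x) | rewrite -fi !gK].
exists g; split=> // A mA.
rewrite -fmu; last exact: isometry_borel.
by congr (mm_measure X _); apply/funext => x /=; rewrite fK.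
Qed.

Lemma mm_isomorphic_trans : transitive mm_isomorphic.
Proof.
move=> Y X Z /asboolP[f [[fs fi] fmu]] /asboolP[g [[gs gi] gmu]].
apply/asboolP; exists (g \o f); split.
  split=> [z|x1 x2]; last by rewrite /= gi fi.
  by have [y <-] := gs z; have [x <-] := fs y; exists x.
by move=> A mA; rewrite comp_preimage fmu ?gmu//; exact: isometry_borel.
Qed.

Canonical mm_isomorphic_equiv :=
  EquivRel mm_isomorphic mm_isomorphic_refl mm_isomorphic_sym
    mm_isomorphic_trans.

Definition box_class := {eq_quot mm_isomorphic_equiv}.

Definition coupling (X Y : mmSpace) :
    set {measure set (borel (X * Y)%type) -> \bar R} :=
  [set pi |
    (forall A : set (borel X), measurable A ->
       pi (fst @^-1` A) = mm_measure X A) /\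
    (forall B : set (borel Y), measurable B ->
       pi (snd @^-1` B) = mm_measure Y B)].

(* Both minima of the definition are attained and hence are infima. *)
Definition box_dist (X Y : mmSpace) : R :=
  fine (ereal_inf [set
    ereal_inf [set maxe (1 - pi S)%E (distortion S) | S in @closed (X * Y)%type]
    | pi in @coupling X Y]).

Definition box_class_dist (c1 c2 : box_class) : R :=
  box_dist (repr c1) (repr c2).

Definition box_points (n : nat) : set box_class :=
  [set c | has_points (repr c : mmSpace) n].

Definition box_subspace (n : nat) : topologicalType :=
  dist_space (fun x y : box_points n => box_class_dist (val x) (val y)).

End mm_spaces.

(* Main.v *)
Require Import Defs.
From HB Require Import structures.
From mathcomp Require Import all_boot all_order all_algebra all_fingroup generic_quotient.
From mathcomp Require Import all_classical all_reals all_analysis.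
From mathcomp Require Import zify lra.

(** For both spaces a point has, for each labelling of its [n] points by
    [0, ..., n - 1], a family of real coordinates: the [n (n - 1) / 2] distances,
    and in the second case also the [n] weights, whose sum is 1. Two families
    of the same point differ by a permutation of the labels, and nearby points
    have nearby coordinates for suitable labellings. Let [k] be the claimed
    dimension.

    Upper bound: choose dense disjoint sets [D_0, ..., D_k] of rationals, [D_j]
    consisting of those of 2-adic valuation [- (j + 1)]. Every family of
    coordinates avoids some [D_j] (for the weights this uses that numbers with
    distinct negative valuations do not add up to 1), so the points avoiding
    [D_j] can be covered by disjoint open sets obtained from boxes with end
    points in [D_j]; the [k + 1] families form a refinement of order [k].

    Lower bound: a [k]-cube of coordinates, in which different distances (and
    weights) range over disjoint intervals so that the labelling is
    determined, maps to the space with opposite faces in disjoint closed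
    sets, and Lebesgue's covering theorem, here derived from Kuhn's cubical
    version of Sperner's lemma, applies. *)

Set Implicit Arguments.
Unset Strict Implicit.
Unset Printing Implicit Defensive.

Import Order.TTheory GRing.Theory Num.Theory.
Import numFieldNormedType.Exports.
Local Open Scope classical_set_scope.
Local Open Scope card_scope.
Local Open Scope ring_scope.
Local Open Scope quotient_scope.

(** * Kuhn's cubical Sperner lemma *)

Lemma F2_addrr (a : 'F_2) : a + a = 0.
Proof. by rewrite -mulr2n -mulr_natr [2%:R](_ : _ = 0) ?mulr0//; apply/val_inj. Qed.

Lemma F2_oppr (a : 'F_2) : - a = a.
Proof. by apply/esym/eqP; rewrite -addr_eq0 F2_addrr. Qed.

Lemma F2_sign (j : nat) : (-1) ^+ j = 1 :> 'F_2.
Proof. by rewrite F2_oppr expr1n. Qed.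

(** The involution swaps the part of [P] inside [Q] with the part outside, so terms come in equal
    pairs and cancel in characteristic 2. [Q] rules out fixed points and selects one member of each
    pair. *)
Lemma F2_sum_involution (I : finType) (P Q : pred I) (h : I -> I) (F : I -> 'F_2) :
  involutive h -> (forall i, P (h i) = P i) -> (forall i, P i -> Q (h i) = ~~ Q i) ->
  (forall i, P i -> F (h i) = F i) -> \sum_(i | P i) F i = 0.
Proof.
move=> hK hP hQ hF; rewrite (bigID Q)/= addrC.
rewrite (reindex_inj (inv_inj hK)).
rewrite [X in X + _](_ : _ = \sum_(i | P i && Q i) F i) ?F2_addrr//.
apply: eq_big => [i|i]; rewrite hP; first by case: (boolP (P i)) => //= /hQ ->; rewrite negbK.
by move=> /andP[/hF].
Qed.

(* [A] fixes the all-one column [u], so [\adj A *m u = \adj A *m A *m u = \det A *: u]. *)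
Lemma det_row_sum1 m (A : 'M['F_2]_m.+1) : (forall i, \sum_j A i j = 1) ->
  \det A = \sum_i \det (row' i (col' ord_max A)).
Proof.
move=> A1; have : \adj A *m A *m const_mx (n:=1) 1 = \adj A *m const_mx 1.
  rewrite -mulmxA; congr (_ *m _); apply/matrixP => i j.
  by rewrite !mxE -[RHS](A1 i); apply: eq_bigr => l _; rewrite mxE mulr1.
move=> /matrixP/(_ ord_max ord0); rewrite mul_adj_mx mul_scalar_mx !mxE mulr1 => ->.
by apply: eq_bigr => i _; rewrite !mxE mulr1 /cofactor F2_sign mul1r.
Qed.

Section Kuhn.
Variables (k N : nat) (lab : ('I_k -> nat) -> nat).
Hypothesis lab_le : forall v, (lab v <= k)%N.
Hypothesis lab_low : forall v (i : 'I_k), v i = 0%N -> (lab v <= i)%N.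
Hypothesis lab_high : forall v (i : 'I_k), v i = N.+1 -> lab v <> i.

Let flag : finType := ({ffun 'I_k -> 'I_N.+1} * 'S_k)%type.

(* The simplex of the Kuhn triangulation of the grid [0, N + 1]^k attached to
   a base cube and an ordering of the directions. *)
Definition kuhn_vertex (p : flag) (l : nat) : 'I_k -> nat :=
  fun i => (p.1 i + (p.2 i < l))%N.

(** The first [m + 1] vertices of such a flag span a simplex of the grid face where the coordinates
    from [m] on vanish. Fixing the order of the remaining directions counts each simplex of that
    face once. *)
Definition kuhn_face (m : nat) (p : flag) : bool :=
  [forall i : 'I_k, (m <= i)%N ==> ((p.1 i == 0 :> nat) && (p.2 i == i))].

(** This is 1 exactly when the labels of the first [m] vertices are 0, ..., [m - 1] in some order,
    and 0 otherwise: each row has at most one nonzero entry. *)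
Definition label_det (m : nat) (v : nat -> 'I_k -> nat) : 'F_2 :=
  \det (\matrix_(l < m, j < m) (lab (v l) == j)%:R).

Definition facet (p : flag) (l : nat) : nat -> 'I_k -> nat :=
  fun a => kuhn_vertex p (bump l a).

Lemma eq_label_det m v w : (forall l, (l < m)%N -> v l = w l) ->
  label_det m v = label_det m w.
Proof. by move=> vw; congr (\det _); apply/matrixP => i j; rewrite !mxE vw. Qed.

Lemma label_det0 m v (j : 'I_m) : (forall l, (l < m)%N -> lab (v l) <> j) ->
  label_det m v = 0.
Proof.
move=> vj; rewrite /label_det (expand_det_col _ j) big1// => l _.
by rewrite mxE; case: eqP => [/vj|_]; rewrite ?mul0r//; case.
Qed.

Lemma kuhn_faceP m (p : flag) : reflect (forall i : 'I_k, (m <= i)%N -> p.1 i = 0%N :> nat /\ p.2 i = i)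
  (kuhn_face m p).
Proof.
apply: (iffP forallP) => [H i mi|H i].
  by have := H i; rewrite mi => /andP[/eqP -> /eqP ->].
by apply/implyP => /H[-> ->]; rewrite !eqxx.
Qed.

Lemma lab_face m p l : kuhn_face m p -> (l <= m)%N -> (m <= k)%N ->
  (lab (kuhn_vertex p l) <= m)%N.
Proof.
move=> /kuhn_faceP H lm; rewrite leq_eqVlt => /predU1P[->|mk]; first exact: lab_le.
apply: (lab_low (i := Ordinal mk)); rewrite /kuhn_vertex.
by have [-> ->] := H (Ordinal mk) (leqnn _); rewrite /= ltnNge lm.
Qed.

(** The parity of the number of completely labelled simplices in the [m]-dimensional face; the
    induction shows that it does not depend on [m]. *)
Definition face_sum m := \sum_(p | kuhn_face m p) label_det m.+1 (kuhn_vertex p).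

Lemma face_sum0 : face_sum 0 = 1.
Proof.
pose p0 : flag := ([ffun _ => ord0], 1%g).
rewrite /face_sum (bigD1 p0)/=; last by apply/kuhn_faceP => i _; rewrite ffunE perm1.
rewrite big1 ?addr0 => [|p /andP[/kuhn_faceP H /eqP []]]; last first.
  rewrite [p]surjective_pairing; congr (_, _).
    by apply/ffunP => i; apply/val_inj; rewrite ffunE; have [] := H i isT.
  by apply/permP => i; rewrite perm1; have [] := H i isT.
rewrite /label_det det_mx11 mxE.
suff : (lab (kuhn_vertex p0 0) <= 0)%N by rewrite leqn0 => /eqP ->.
by apply: lab_face => //; apply/kuhn_faceP => i _; rewrite ffunE perm1.
Qed.

Section step.
Variable m : nat.
Hypothesis mk : (m < k)%N.

Let om := Ordinal mk.
Let o0 : 'I_k := Ordinal (leq_ltn_trans (leq0n m) mk).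

(** Labels on this face are at most [m + 1], so every row of the matrix sums to 1 and [det_row_sum1]
    applies; deleting row [l] and the last column leaves the matrix of the facet opposite vertex
    [l]. *)
Lemma label_det_facets p : kuhn_face m.+1 p ->
  label_det m.+2 (kuhn_vertex p) = \sum_(l < m.+2) label_det m.+1 (facet p l).
Proof.
move=> fp; rewrite /label_det det_row_sum1 => [|l].
  apply: eq_bigr => l _; congr (\det _); apply/matrixP => i j; rewrite !mxE.
  by rewrite /facet lift_max.
under eq_bigr do rewrite mxE.
have lm : (lab (kuhn_vertex p l) < m.+2)%N by rewrite ltnS lab_face// -ltnS.
rewrite (bigD1 (Ordinal lm))//= eqxx big1 ?addr0// => j; rewrite -val_eqE/= eq_sym.
by move=> /negbTE ->.
Qed.

(** The facet opposite an inner vertex [l] belongs to exactly two simplices with the same base cube,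
    related by exchanging the directions in positions [l - 1] and [l]: only vertex [l] changes. *)
Lemma sum_facet_inner l : (0 < l <= m)%N ->
  \sum_(p | kuhn_face m.+1 p) label_det m.+1 (facet p l) = 0.
Proof.
move=> /andP[l0 lm]; have lk : (l < k)%N by lia.
have l1k : (l.-1 < k)%N by lia.
pose a : 'I_k := Ordinal l1k; pose b : 'I_k := Ordinal lk.
have ab : a != b by rewrite -val_eqE/=; lia.
pose h (p : flag) : flag := (p.1, (p.2 * tperm a b)%g).
have hK : involutive h by move=> [x s]; rewrite /h/= -mulgA tperm2 mulg1.
have hf p : kuhn_face m.+1 p -> kuhn_face m.+1 (h p).
  move=> /kuhn_faceP H; apply/kuhn_faceP => i mi; have [xi si] := H i mi; split => //=.
  by rewrite permM si tpermD// -val_eqE/=; lia.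
pose Q (p : flag) := (p.2^-1%g a < p.2^-1%g b)%N.
apply: (F2_sum_involution (Q := Q) hK).
- by move=> p; apply/idP/idP => [/hf|/hf//]; rewrite hK.
- move=> p _; rewrite /Q /h/= invMg tpermV !permM tpermL tpermR.
  have : p.2^-1%g a != p.2^-1%g b :> nat by rewrite (inj_eq val_inj) (inj_eq perm_inj).
  by case: ltngtP.
- move=> p _; apply: eq_label_det => c cm; apply/funext => i.
  rewrite /facet /kuhn_vertex/= permM; congr (_ + nat_of_bool _)%N.
  have cl : bump l c <> l by rewrite /bump; lia.
  case: tpermP => [->|->|//]; rewrite /a /b/=; move: cl; lia.
Qed.

Let cyc_fun (j : 'I_k) : 'I_k :=
  insubd j (if j == 0 :> nat then m else if (j <= m)%N then j.-1 else j).

Let cyc_funE j : cyc_fun j = (if j == 0 :> nat then m else if (j <= m)%N then j.-1 else j) :> nat.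
Proof.
rewrite /cyc_fun val_insubd; case: ifP => // /negP[]; have := ltn_ord j; repeat case: ifPn => ?; lia.
Qed.

Let cyc_inj : injective cyc_fun.
Proof.
move=> i j /(congr1 val); rewrite /= !cyc_funE => e; apply/val_inj => /=.
move: e; repeat case: ifPn => ?; lia.
Qed.

Let cyc := perm cyc_inj.

Let cycE j : cyc j = (if j == 0 :> nat then m else if (j <= m)%N then j.-1 else j) :> nat.
Proof. by rewrite permE cyc_funE. Qed.

Let cyc0 : cyc o0 = om. Proof. by apply/val_inj; rewrite /= cycE. Qed.

(** The neighbour across the facet opposite vertex 0: the base cube moves one step in the first
    direction, which then becomes the last one. It makes sense only under [top_free], as [inord]
    would otherwise leave the grid. *)
Let up (p : flag) : flag :=
  ([ffun i => if p.2 i == o0 then inord (p.1 i).+1 else p.1 i], (p.2 * cyc)%g).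

Let down (p : flag) : flag :=
  ([ffun i => if p.2 i == om then inord (p.1 i).-1 else p.1 i], (p.2 * cyc^-1)%g).

Let top_free (p : flag) := (p.1 (p.2^-1 o0)%g < N)%N.
Let bottom_free (p : flag) := (0 < p.1 (p.2^-1 om)%g)%N.

Let downK p : bottom_free p -> up (down p) = p.
Proof.
case: p => x s; rewrite /bottom_free /up /down/= => b; congr (_, _); last first.
  by rewrite -mulgA mulVg mulg1.
apply/ffunP => i; rewrite !ffunE permM -(inj_eq (@perm_inj _ cyc)) permKV cyc0.
have [e|//] := eqVneq; apply/val_inj; move: b; rewrite -e permK /= => b.
have xN := ltn_ord (x i).
have e1 : @inord N (x i).-1 = (x i).-1 :> nat by rewrite inordK//; lia.
by rewrite /= inordK e1 prednK.
Qed.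

Let upK p : top_free p -> down (up p) = p.
Proof.
case: p => x s; rewrite /top_free /up /down/= => b; congr (_, _); last first.
  by rewrite -mulgA mulgV mulg1.
apply/ffunP => i; rewrite !ffunE permM -cyc0 (inj_eq (@perm_inj _ cyc)).
have [e|//] := eqVneq; apply/val_inj; move: b; rewrite -e permK /= => b.
have e1 : @inord N (x i).+1 = (x i).+1 :> nat by rewrite inordK.
by rewrite /= inordK e1//= ltnW.
Qed.

Let up_bottom p : top_free p -> bottom_free (up p).
Proof.
case: p => x s; rewrite /top_free /bottom_free /up/= => b.
by rewrite invMg permM -cyc0 permK ffunE permKV eqxx inordK.
Qed.

Let down_top p : bottom_free p -> top_free (down p).
Proof.
case: p => x s; rewrite /top_free /bottom_free /down/= => b.
rewrite invMg invgK permM cyc0 ffunE permKV eqxx.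
by rewrite inordK ?(leq_ltn_trans (leq_pred _) (ltn_ord _))// -ltnS prednK.
Qed.

Let up_face p : kuhn_face m.+1 p -> kuhn_face m.+1 (up p).
Proof.
move=> /kuhn_faceP H; apply/kuhn_faceP => i mi; have [xi si] := H i mi.
rewrite /= ffunE permM si -val_eqE/= ifF ?xi; last by apply/eqP; lia.
by split => //; apply/val_inj; rewrite /= cycE; repeat case: ifPn => ?; lia.
Qed.

Let down_face p : kuhn_face m.+1 p -> kuhn_face m.+1 (down p).
Proof.
move=> /kuhn_faceP H; apply/kuhn_faceP => i mi; have [xi si] := H i mi.
rewrite /= ffunE permM si -val_eqE/= ifF ?xi; last by apply/eqP; lia.
by split => //; apply: (@perm_inj _ cyc); rewrite permKV; apply/val_inj; rewrite /= cycE; repeat case: ifPn => ?; lia.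
Qed.

Let facet_up p a : top_free p -> (a <= m)%N -> facet (up p) m.+1 a = facet p 0 a.
Proof.
case: p => x s b am; apply/funext => i; rewrite /facet /kuhn_vertex/= ffunE permM cycE.
have -> : bump m.+1 a = a by rewrite /bump ltnNge am.
have -> : bump 0 a = a.+1 by [].
have [e|] := eqVneq; last by rewrite -val_eqE/=; repeat case: ifPn => ?; lia.
rewrite inordK; first by rewrite e /=; lia.
by move: b; rewrite /top_free/= -e permK.
Qed.

(** Without [top_free] the facet lies where coordinate [i] is [N + 1], [i] being the first
    direction; label [i] is missing there, so the determinant vanishes. *)
Let sum_top : \sum_(p | kuhn_face m.+1 p) label_det m.+1 (facet p 0) =
  \sum_(p | kuhn_face m.+1 p && top_free p) label_det m.+1 (facet p 0).
Proof.
rewrite (bigID top_free)/= [X in _ + X]big1 ?addr0// => p /andP[fp tp].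
have sp : (p.2^-1 o0 < m.+1)%g%N.
  rewrite ltnNge; apply/negP => ms; have /kuhn_faceP/(_ _ ms)[_] := fp.
  by rewrite permKV => e; move: ms; rewrite -e.
apply: (label_det0 (j := Ordinal sp)) => l lm /=; apply: lab_high.
rewrite /facet /kuhn_vertex permKV /= addn1; congr _.+1.
by apply/eqP; rewrite eqn_leq -ltnS ltn_ord leqNgt.
Qed.

(** Facets opposite the last vertex either are shared with the simplex below, or lie where the
    coordinate of the last direction [i] is 0. In the latter case labels are at most [i], so label
    [m] is missing if [i < m]; if [i = m], the facet is a simplex of the [m]-dimensional face. *)
Let sum_bottom : \sum_(p | kuhn_face m.+1 p) label_det m.+1 (facet p m.+1) =
  \sum_(p | kuhn_face m.+1 p && top_free p) label_det m.+1 (facet p 0) + face_sum m.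
Proof.
rewrite (bigID bottom_free)/=; congr (_ + _).
  rewrite (reindex_onto up down) => [|p /andP[_ /downK//]].
  have topP p : kuhn_face m.+1 (up p) && bottom_free (up p) && (down (up p) == p) =
      kuhn_face m.+1 p && top_free p.
    apply/andP/andP => [[/andP[fp bp] /eqP e]|[fp tp]].
      by rewrite -e; split; [exact: down_face|exact: down_top].
    by rewrite upK// up_face ?up_bottom.
  apply: eq_big => // p; rewrite topP => /andP[_ tp].
  by apply: eq_label_det => a am; rewrite facet_up.
rewrite [RHS](bigID (fun p => kuhn_face m.+1 p && ~~ bottom_free p))/=.
have faceS p : kuhn_face m p = [&& kuhn_face m.+1 p, ~~ bottom_free p & p.2 om == om].
  apply/kuhn_faceP/and3P => [H|[/kuhn_faceP H b /eqP so] i].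
    have [xo so] := H om (leqnn m); split; last by apply/eqP.
      by apply/kuhn_faceP => i mi; apply: H; exact: ltnW.
    by rewrite /bottom_free -{1}so permK xo.
  rewrite leq_eqVlt => /predU1P[|/H//].
  move=> e; have -> : i = om by apply/val_inj.
  split=> //; apply/eqP; rewrite -leqn0 leqNgt.
  by move: b; rewrite /bottom_free -{1}so permK.
rewrite [X in _ = _ + X]big1 ?addr0 => [|p]; last first.
  by rewrite faceS => /andP[/and3P[-> ->]].
rewrite (bigID (fun p : flag => p.2 om == om))/= [X in _ + X]big1 ?addr0.
  apply: eq_big => p; first by rewrite faceS; case: (kuhn_face _ _); case: (bottom_free _); case: (_ == _).
  move=> _; apply: eq_label_det => a am; rewrite /facet.
  by have -> : bump m.+1 a = a by rewrite /bump leqNgt ltnS -ltnS am.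
move=> p /andP[/andP[fp bp] so].
pose i0 := (p.2^-1 om)%g.
have i0m : (i0 < m)%N.
  rewrite ltn_neqAle; apply/andP; split.
    apply: contra so => /eqP i0m; have <- : i0 = om by apply/val_inj.
    by rewrite permKV; apply/eqP/val_inj.
  rewrite -ltnS ltnNge; apply/negP => mi; have /kuhn_faceP/(_ _ mi)[_] := fp.
  by rewrite permKV => e; move: mi; rewrite -e /= ltnn.
apply: (label_det0 (j := ord_max)) => a am /= labm.
have : (lab (facet p m.+1 a) <= i0)%N.
  apply: lab_low; rewrite /facet /kuhn_vertex permKV.
  have -> : bump m.+1 a = a by rewrite /bump leqNgt am.
  by rewrite /= ltnNge -ltnS am/= addn0; apply/eqP; rewrite -leqn0 leqNgt.
by rewrite labm leqNgt i0m.
Qed.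

Lemma face_sumS : face_sum m.+1 = face_sum m.
Proof.
rewrite /face_sum (eq_bigr _ label_det_facets) exchange_big/=.
rewrite big_ord_recl big_ord_recr/= [X in _ + (X + _)]big1 => [|l _]; last first.
  exact: (sum_facet_inner (l := l.+1) (ltn_ord l)).
by rewrite add0r sum_top sum_bottom addrA F2_addrr add0r.
Qed.

End step.

(* The number of completely labelled simplices is odd. *)
Theorem kuhn_sperner : exists p : flag,
  injective (fun l : 'I_k.+1 => lab (kuhn_vertex p l)).
Proof.
have full m : (m <= k)%N -> face_sum m = 1.
  by elim: m => [_|m IH mk]; [exact: face_sum0|rewrite face_sumS//; apply: IH; exact: ltnW].
have : face_sum k != 0 by rewrite full ?oner_eq0.
rewrite /face_sum; case: (pickP (fun p : flag => label_det k.+1 (kuhn_vertex p) != 0)) => [p dp _|H].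
  exists p => i j e; apply/eqP/negPn/negP => ij; move/negP: dp; apply.
  by apply/eqP/(determinant_alternate ij) => l; rewrite !mxE e.
by rewrite big1 ?eqxx// => p _; apply/eqP; have /negbFE := H p.
Qed.

End Kuhn.

(** * Lebesgue's covering theorem *)

Section cube.
Variables (R : realType) (k : nat).

Definition cube : set 'rV[R]_k := [set t | forall i, 0 <= t ord0 i <= 1].

Definition cube_close (d : R) (t s : 'rV[R]_k) := forall i, `|t ord0 i - s ord0 i| < d.

Lemma lebesgue_number (S : set (set 'rV[R]_k)) :
  (forall t, cube t -> exists2 A, S A &
     exists2 d, 0 < d & forall s, cube s -> cube_close d t s -> A s) ->
  exists2 d, 0 < d & forall t, cube t -> exists2 A, S A &
    forall s, cube s -> cube_close d t s -> A s.
Proof.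
move=> cov.
have : compact cube.
  rewrite (_ : cube = [set t : 'rV[R]_k | forall i, `[0, 1]%classic (t ord0 i)]).
    by apply: (@rV_compact R k (fun=> `[0, 1]%classic)) => _; exact: segment_compact.
  by apply/seteqP; split=> t ct i; have := ct i; rewrite /= in_itv.
move=> /compact_near_coveringP ncov.
pose P d (t : 'rV[R]_k) := exists2 A, S A & forall s, cube s -> cube_close d t s -> A s.
have PF : \forall d \near (0 : R)^'+, cube `<=` P d.
  apply: ncov => t /cov[A SA [d d0 dA]].
  (* Half of [d] is spent on the way from [t] to [s], the other half on the way from [s] to [u]. *)
  exists (ball t (d / 2), [set e | e < d / 2]) => /=.
    split; first by apply: nbhsx_ballx; lra.
    by apply: nbhs_right_lt; lra.
  move=> [s e]/= [[_ ts] ed]; exists A => // u cu us; apply: dA => // i.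
  have := ts ord0 i; rewrite /ball/= => tsi; have usi := us i.
  rewrite [d](_ : _ = d / 2 + d / 2); last by lra.
  rewrite -(subrK (s ord0 i) (t ord0 i)) -addrA.
  by apply: (le_lt_trans (ler_normD _ _)); apply: ltrD => //; exact: lt_trans usi _.
by have [d [d0 dH]] := filter_ex (filterI (nbhs_right_gt (0 : R)) PF); exists d.
Qed.

End cube.

Section covering_theorem.
Variables (R : realType) (T : topologicalType) (j k : nat).
Variables (f : 'rV[R]_k -> T) (K : 'I_k -> bool -> set T).

(* [K i b] plays the role of the image of the face [t_i = b] of the cube. *)
Theorem dim_le_cube :
  (forall U t, open U -> cube t -> U (f t) ->
     exists2 d, 0 < d & forall s, cube s -> cube_close d t s -> U (f s)) ->
  (forall i b, closed (K i b)) -> (forall i, K i false `&` K i true = set0) ->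
  (forall t i (b : bool), cube t -> t ord0 i = b%:R -> K i b (f t)) ->
  dim_le T j -> (k <= j)%N.
Proof.
move=> fc Kc K0 fK dimT.
(* Sets of this cover, and hence of any refinement, miss one of the two opposite faces in each
   direction. *)
pose U := [set A : set T | open A /\ forall i, exists b, A `&` K i b = set0].
have Ucov : open_cover U.
  split=> [A []//|]; apply/seteqP; split=> // x _.
  have Kx i : exists b, ~ K i b x.
    apply: contrapT => /forallNP H.
    have : (K i false `&` K i true) x by split; apply: contrapT; apply: H.
    by rewrite K0.
  have [b bx] := choice Kx.
  exists (~` \bigcup_(i in [set: 'I_k]) K i (b i)); last by move=> [i _]; exact: bx.
  split; first by rewrite openC; apply: closed_bigcup => //; exact: finite_finset.
  by move=> i; exists (b i); rewrite -subset0 => y [/[swap] Ky []]; exists i.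
have [V [[Vo Vcov] VU Vord]] := dimT _ Ucov.
have [|d d0 dV] := @lebesgue_number R k [set f @^-1` A | A in V].
  move=> t ct; have : (\bigcup_(A in V) A) (f t) by rewrite Vcov.
  move=> [A VA Aft]; have [d d0 dA] := fc _ _ (Vo _ VA) ct Aft.
  by exists (f @^-1` A); [exists A|exists d].
pose N := Num.truncn d^-1.
have Nd : (N.+1%:R)^-1 < d.
  by rewrite invf_plt ?posrE//; exact: truncnS_gt.
pose pt (v : 'I_k -> nat) : 'rV[R]_k := \row_i ((minn (v i) N.+1)%:R / N.+1%:R).
have cpt v : cube (pt v).
  by move=> i; rewrite mxE divr_ge0//= ler_pdivrMr// mul1r ler_nat geq_minr.
have {}dV v : exists A, V A /\ forall s, cube s -> cube_close d (pt v) s -> A (f s).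
  by have [_ [A VA <-] H] := dV _ (cpt v); exists A.
have [A AP] := choice dV.
have Ab v i (b : bool) : pt v ord0 i = b%:R -> A v `&` K i (~~ b) = set0.
  move=> vb; have [B [_ /(_ i)[c Bc]] AB] := VU _ (AP v).1.
  suff <- : c = ~~ b by rewrite -subset0 -Bc; exact: setSI.
  have [//|cb] : c = ~~ b \/ c = b by case: (c); case: (b); auto.
  suff : (B `&` K i c) (f (pt v)) by rewrite Bc.
  split; last by rewrite cb; exact: fK.
  by apply: AB; apply: (AP v).2 => // l; rewrite subrr normr0.
pose missed (B : set T) (i : 'I_k) := `[< B `&` K i true = set0 >].
(* The label is the first direction whose face [K i true] is missed, or [k] if there is none. At
   [v i = 0] the chosen set meets [K i false], hence misses [K i true]; at [v i = N + 1] it meets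
   [K i true], so its label is not [i]. *)
pose lab (B : set T) : nat := find (missed B) (enum 'I_k).
have pt0 v (i : 'I_k) : v i = 0%N -> pt v ord0 i = false%:R.
  by move=> vi; rewrite mxE vi min0n mul0r.
have ptN v (i : 'I_k) : v i = N.+1 -> pt v ord0 i = true%:R.
  by move=> vi; rewrite mxE vi minnn divff.
have [] := @kuhn_sperner k N (lab \o A).
- by move=> v /=; rewrite -[k in (_ <= k)%N]size_enum_ord find_size.
- move=> v i /pt0/Ab Ai; rewrite leqNgt; apply/negP => /(before_find i).
  by rewrite nth_ord_enum; move/asboolP.
- move=> v i vi /= lv; have hm : has (missed (A v)) (enum 'I_k).
    by rewrite has_find size_enum_ord -/(lab _) lv.
  have := nth_find i hm; rewrite -/(lab _) lv nth_ord_enum => /asboolP At.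
  have Af := Ab _ _ true (ptN _ _ vi).
  have [B [_ /(_ i)[c Bc]] AB] := VU _ (AP v).1.
  suff : (A v `&` K i true) (f (pt v)) by rewrite At.
  split; last exact: fK (cpt v) (ptN _ _ vi).
  by apply: (AP v).2 => // l; rewrite subrr normr0.
move=> p labinj.
(* All vertices of the simplex are within the mesh width, less than [d], of vertex 0. The image of
   vertex 0 thus lies in [k + 1] sets of [V], distinct because their labels are. *)
have vert l : A (kuhn_vertex p l) (f (pt (kuhn_vertex p 0))).
  apply: (AP _).2 => // i; rewrite !mxE; apply: le_lt_trans Nd.
  rewrite -mulrBl normrM (ger0_norm (_ : 0 <= N.+1%:R^-1)) ?invr_ge0//.
  rewrite -[leRHS]mul1r; apply: ler_wpM2r; first by rewrite invr_ge0.
  rewrite /kuhn_vertex addn0; have := ltn_ord (p.1 i); move: (_ < l)%N => b pN.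
  have -> : (minn (p.1 i + b) N.+1 = p.1 i + b)%N by case: b; lia.
  have -> : (minn (p.1 i) N.+1 = p.1 i)%N by lia.
  by rewrite natrD addrC addKr; case: b; rewrite ?normr1 ?normr0.
have := Vord (f (pt (kuhn_vertex p 0))).
set W := [set B | _] => WI.
rewrite -ltnS -card_le_II; apply: card_le_trans WI.
pose g (l : nat) : set T := A (kuhn_vertex p l).
have ginj : {in `I_k.+1 &, injective g}.
  move=> a b; rewrite !inE/= => ak bk gab.
  suff /(congr1 val) : Ordinal ak = Ordinal bk by [].
  by apply: labinj; rewrite /= -/(g a) gab.
rewrite -(card_le_eql (inj_card_eq ginj)); apply: subset_card_le => _ [l _ <-].
by split; [exact: (AP _).1|exact: vert].
Qed.

End covering_theorem.

(** * Spaces described by coordinates up to finitely many relabellings *)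

(** The inverse of 1 plus the sum of the inverses also serves when [F] is empty and there is no
    minimum. *)
Lemma finite_lower_bound (R : realType) (F : finType) (e : F -> R) :
  (forall g, 0 < e g) -> exists2 d, 0 < d & forall g, d <= e g.
Proof.
move=> e0; have s0 : 0 <= \sum_g (e g)^-1.
  by apply: sumr_ge0 => g _; rewrite invr_ge0 ltW.
exists (1 + \sum_g (e g)^-1)^-1; first by rewrite invr_gt0 ltr_pwDl.
move=> g; rewrite -[leRHS]invrK lef_pV2 ?posrE ?invr_gt0 ?ltr_pwDl//.
rewrite (bigD1 g)//= addrCA lerDl addr_ge0//.
by apply: sumr_ge0 => h _; rewrite invr_ge0 ltW.
Qed.

Section coordinates.
Variables (R : realType) (I : finType).
Implicit Types (x y : I -> R) (B : set (I -> R)).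

Definition near_coord e x y := forall i, `|x i - y i| < e.

Definition coord_open B := forall x, B x -> exists2 e, 0 < e &
  forall y, near_coord e x y -> B y.

Definition open_box (lo hi : I -> R) : set (I -> R) :=
  [set x | forall i, lo i < x i < hi i].

Definition closed_box (lo hi : I -> R) : set (I -> R) :=
  [set x | forall i, lo i <= x i <= hi i].

Lemma open_box_open lo hi : coord_open (open_box lo hi).
Proof.
move=> x xb; have [|d d0 de] := @finite_lower_bound R I
  (fun i => Num.min (x i - lo i) (hi i - x i)).
  by move=> i; rewrite lt_min !subr_gt0; have /andP[-> ->] := xb i.
exists d => // y xy i; have := de i; rewrite le_min => /andP[].
by have := xy i; rewrite ltr_norml => /andP[]; lra.
Qed.

Lemma closed_box_closed lo hi : coord_open (~` closed_box lo hi).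
Proof.
move=> x /existsNP[i /negP]; rewrite negb_and -!ltNge => /orP[xi|xi].
  exists (lo i - x i); first by rewrite subr_gt0.
  by move=> y /(_ i) + /(_ i); rewrite ltr_norml => /andP[]; lra.
exists (x i - hi i); first by rewrite subr_gt0.
by move=> y /(_ i) + /(_ i); rewrite ltr_norml => /andP[]; lra.
Qed.

Variables (T : topologicalType) (G : finType) (act : G -> I -> I).

(* [coords c x]: the family [x] lists the coordinates of [c] for some labelling. *)
Variable coords : T -> (I -> R) -> Prop.

(** The last two fields stand for openness and continuity of the map sending a family of coordinates
    to its point. *)
Record coordinate_system : Prop := CoordinateSystem {
  coords_ex : forall c, exists x, coords c x;
  coords_relabel : forall c x y, coords c x -> coords c y ->
    exists g, y = x \o act g;
  coords_act : forall c x g, coords c x -> coords c (x \o act g);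
  coords_open : forall B, coord_open B -> open [set c | exists2 x, coords c x & B x];
  coords_cont : forall U c x, open U -> U c -> coords c x ->
    exists2 e, 0 < e & forall c' y, coords c' y -> near_coord e x y -> U c' }.

Hypothesis sys : coordinate_system.

(** The complement consists of the points with a family none of whose relabellings is in [B]; as
    there are finitely many relabellings, these families form an open set. *)
Lemma coords_closed B : coord_open (~` B) -> closed [set c | exists2 x, coords c x & B x].
Proof.
move=> oB; rewrite -openC.
rewrite (_ : ~` _ = [set c | exists2 x, coords c x & forall g, ~ B (x \o act g)]).
  apply: coords_open => // x Bx.
  have /choice[e eP] : forall g, exists e, 0 < e /\
      forall y, near_coord e (x \o act g) y -> ~ B y.
    by move=> g; have [e e0 eP] := oB _ (Bx g); exists e.
  have [d d0 de] := finite_lower_bound (fun g => (eP g).1).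
  exists d => // y xy g; apply: (eP g).2 => i /=.
  by apply: lt_le_trans (de g); exact: xy.
apply/seteqP; split=> c /=.
  move=> H; have [x cx] := coords_ex sys c; exists x => // g Bx.
  by apply: H; exists (x \o act g) => //; exact: coords_act.
move=> [x cx H] [y cy]; have [g ->] := coords_relabel sys cx cy.
exact: H.
Qed.

Section upper_bound.
Variables (k : nat) (q : 'I_k.+1 -> nat -> R).
Hypothesis q_dense : forall j a b, a < b -> exists m, a < q j m < b.
Hypothesis q_avoid : forall c x, coords c x -> exists j, forall i m, x i <> q j m.

Let boxes : Type := {ffun I -> nat * nat}.
Let lo j (b : boxes) i := q j (b i).1.
Let hi j (b : boxes) i := q j (b i).2.
Let W j b : set T := [set c | exists2 x, coords c x & open_box (lo j b) (hi j b) x].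
Let C j b : set T := [set c | exists2 x, coords c x & closed_box (lo j b) (hi j b) x].

(* For fixed [j] the sets [V j b] are disjoint; a point one of whose coordinate
   families avoids all [q j m] lies on the boundary of no box. *)
Theorem coord_dim_le : dim_le T k.
Proof.
move=> U [Uo Ucov].
pose good j b := exists2 A, U A & W j b `<=` A.
pose prev j (b : boxes) : set boxes := [set b' | good j b' /\ (pickle b' < pickle b)%N].
pose V j b := W j b `\` \bigcup_(b' in prev j b) C j b'.
have WC j b : W j b `<=` C j b.
  move=> c [x cx xb]; exists x => // i; have /andP[] := xb i.
  by move=> /ltW -> /ltW ->.
have Vuniq j b b' c : good j b -> good j b' -> V j b c -> V j b' c -> b = b'.
  move=> gb gb' [Wb nb] [Wb' nb'].
  case: (ltngtP (pickle b) (pickle b')) => [lt|lt|]; last exact: (pcan_inj pickleK).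
    by case: nb'; exists b => //; exact: WC.
  by case: nb; exists b' => //; exact: WC.
exists [set A | exists j b, good j b /\ A = V j b]; split.
- split=> [_ [j [b [gb ->]]]|].
    apply: openI; first by apply: coords_open => //; exact: open_box_open.
    rewrite openC; apply: closed_bigcup => [|b' _].
      apply: (@sub_finite_set _ _ (pickle @^-1` `I_(pickle b))); first by move=> ? [].
      apply: finite_preimage => [|]; last exact: finite_II.
      by move=> ? ? _ _; exact: (pcan_inj pickleK).
    by apply: coords_closed; exact: closed_box_closed.
  apply/seteqP; split=> // c _.
  have [x cx] := coords_ex sys c; have [j xj] := q_avoid cx.
  have [A UA Ac] : (\bigcup_(A in U) A) c by rewrite Ucov.
  have [e e0 eP] := coords_cont sys (Uo _ UA) Ac cx.
  have /choice[l lP] : forall i, exists m, x i - e < q j m < x i.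
    by move=> i; apply: q_dense; lra.
  have /choice[r rP] : forall i, exists m, x i < q j m < x i + e.
    by move=> i; apply: q_dense; lra.
  pose b0 : boxes := [ffun i => (l i, r i)].
  have gb0 : good j b0.
    exists A => // c' [y cy yb]; apply: eP cy _ => i.
    have := yb i; rewrite /lo /hi ffunE/= ltr_norml.
    by have := lP i; have := rP i; lra.
  have Wb0 : W j b0 c.
    exists x => // i; rewrite /lo /hi ffunE/=.
    by have /andP[_ ->] := lP i; have /andP[-> _] := rP i.
  (* Among the good boxes containing [c], take the one of least code. If the closed box of an
     earlier good one contained [c], avoidance of the end points would put [c] in the open box,
     against minimality. *)
  have ex : exists n, `[< exists2 b, pickle b = n & good j b /\ W j b c >].
    by exists (pickle b0); apply/asboolP; exists b0.
  have [n /asboolP[b bn [gb Wb]] nmin] := ex_minnP ex.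
  exists (V j b); first by exists j, b.
  split=> // -[b' [gb' b'b] [y cy yb']].
  have : (n <= pickle b')%N.
    apply: nmin; apply/asboolP; exists b' => //; split=> //; exists y => // i.
    have /andP[l1 l2] := yb' i; have [g yE] := coords_relabel sys cx cy.
    rewrite !lt_neqAle l1 l2 !andbT yE /=.
    by apply/andP; split; apply/eqP; [move/esym|]; exact: xj.
  by rewrite leqNgt -bn b'b.
- move=> _ [j [b [[A UA WA] ->]]]; exists A => //.
  by apply: subset_trans WA; exact: subDsetl.
- move=> c.
  (* For each [j] at most one set [V j b] with [b] good contains [c], so [h] reaches all the sets
     through [c] from [k + 1] indices; [set0] is a filler. *)
  pose h (n : nat) : set T := if pselect (exists b, good (inord n) b /\ V (inord n) b c) is left ex
    then V (inord n) (projT1 (cid ex)) else set0.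
  apply: card_le_trans (card_image_le h _); apply: subset_card_le.
  move=> _ [[j [b [gb ->]]] Vc]; exists (j : nat) => //=.
  rewrite /h inord_val; case: pselect => [ex|[]]; last by exists b.
  case: cid => b' [gb' Vc'] /=; congr (V j _); exact: Vuniq Vc' Vc.
Qed.

End upper_bound.

Section lower_bound.
Variables (j k : nat) (p : 'rV[R]_k -> I -> R) (B : 'I_k -> bool -> set (I -> R)).

(** By [coords_cont], any choice of points with coordinates [p t] is continuous on the cube. The
    faces are the points having a family in [B e b]; they are disjoint because no relabelling leads
    from [B e false] to [B e true]. *)
Theorem coord_dim_ge :
  (forall t, cube t -> exists c, coords c (p t)) ->
  (forall d t s, 0 < d -> cube t -> cube s -> cube_close d t s -> near_coord d (p t) (p s)) ->
  (forall e b, coord_open (~` B e b)) ->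
  (forall e x g, B e false x -> B e true (x \o act g) -> False) ->
  (forall t e (b : bool), cube t -> t ord0 e = b%:R -> B e b (p t)) ->
  dim_le T j -> (k <= j)%N.
Proof.
move=> pT pc Bc B0 pB.
have c0 : cube (0 : 'rV[R]_k) by move=> i; rewrite mxE lexx ler01.
have [z _] := pT _ c0.
have /choice[f fP] t : exists c, cube t -> coords c (p t).
  by have [/pT[c cp]|nt] := pselect (cube t); [exists c|exists z].
pose K e b : set T := [set c | exists2 x, coords c x & B e b x].
apply: (@dim_le_cube R T j k f K).
- move=> U t oU ct Uft; have [d d0 dP] := coords_cont sys oU Uft (fP _ ct).
  by exists d => // s cs ts; apply: dP (fP _ cs) _; exact: pc.
- by move=> e b; exact: coords_closed.
- move=> e; rewrite -subset0 => c [[x cx Bx] [y cy By]].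
  have [g yE] := coords_relabel sys cx cy.
  by move: By; rewrite yE; exact: B0 Bx.
- by move=> t e b ct te; exists (p t); [exact: fP|exact: pB].
Qed.

End lower_bound.
End coordinates.

(** * Rationals with a given 2-adic valuation *)

Section two_adic.
Variable R : realType.
Implicit Types x y : R.

(* [x] has 2-adic valuation exactly [- v], respectively at least [- v]. *)
Definition val2 (v : nat) x := exists (a : int) (b : nat),
  x * (b.*2.+1)%:R * 2 ^+ v = (a *+ 2 + 1)%:~R.

Definition val2_ge (v : nat) x := exists (a : int) (b : nat),
  x * (b.*2.+1)%:R * 2 ^+ v = a%:~R.

Let int_pow2 m : ((2 : int) ^+ m)%:~R = 2 ^+ m :> R.
Proof. exact: rmorphXn. Qed.

Lemma val2W v x : val2 v x -> val2_ge v x.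
Proof. by move=> [a [b e]]; exists (a *+ 2 + 1), b. Qed.

Lemma val2_ge_le u v x : (u <= v)%N -> val2_ge u x -> val2_ge v x.
Proof.
move=> uv [a [b e]]; exists (a * 2 ^+ (v - u)), b.
by rewrite -{1}(subnKC uv) exprD mulrA e intrM rmorphXn.
Qed.

Lemma odd_double_mul (b c : nat) :
  (b.*2.+1 * c.*2.+1 = (b * c.*2.+1 + c).*2.+1)%N.
Proof. rewrite -!muln2; lia. Qed.

Lemma val2_geD v x y : val2_ge v x -> val2_ge v y -> val2_ge v (x + y).
Proof.
move=> [a [b e]] [c [d f]]; exists (a * d.*2.+1%:Z + c * b.*2.+1%:Z), (b * d.*2.+1 + d)%N.
rewrite -odd_double_mul intrD !intrM -e -f natrM /=.
rewrite -!pmulrn; move: (_ ^+ _) (_%:R) (_%:R) => X Y Z; lra.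
Qed.

(** Over the common denominator, [y] contributes an even number to the odd numerator of [x]. The
    witness is half of the new numerator minus 1, where [d] comes from [(2 a + 1) (2 d + 1)]. *)
Lemma val2D u v x y : (u < v)%N -> val2 v x -> val2_ge u y -> val2 v (x + y).
Proof.
move=> uv [a [b e]] [c [d f]].
exists (a * d.*2.+1%:Z + d%:Z + c * b.*2.+1%:Z * 2 ^+ (v - u.+1)), (b * d.*2.+1 + d)%N.
have -> : (a * d.*2.+1%:Z + d%:Z + c * b.*2.+1%:Z * 2 ^+ (v - u.+1)) *+ 2 + 1 =
  (a *+ 2 + 1) * d.*2.+1%:Z + c * b.*2.+1%:Z * 2 ^+ (v - u).
  by rewrite subnS -[in RHS](prednK (_ : 0 < v - u)%N) ?subn_gt0// exprS -!muln2; lia.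
rewrite -odd_double_mul intrD !intrM int_pow2 -e -f natrM.
have -> : (2 : R) ^+ v = 2 ^+ u * 2 ^+ (v - u) by rewrite -exprD subnKC// ltnW.
rewrite -!pmulrn; move: ((2 : R) ^+ u) ((2 : R) ^+ (v - u)) (_%:R) (_%:R) => X X' Y Z; lra.
Qed.

(** Clearing denominators equates an odd integer with an even one. *)
Lemma val2_lt u v x : (u < v)%N -> val2 v x -> val2_ge u x -> False.
Proof.
move=> uv [a [b e]] [c [d f]].
have : (a *+ 2 + 1) * d.*2.+1%:Z = c * b.*2.+1%:Z * 2 ^+ (v - u).
  apply: (@intr_inj R); rewrite !intrM int_pow2 -e -f.
  have -> : (2 : R) ^+ v = 2 ^+ u * 2 ^+ (v - u) by rewrite -exprD subnKC// ltnW.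
  rewrite -!pmulrn; move: ((2 : R) ^+ u) ((2 : R) ^+ (v - u)) (_%:R) (_%:R) => X X' Y Z; lra.
rewrite -(prednK (_ : 0 < v - u)%N) ?subn_gt0// exprS -!muln2; lia.
Qed.

Lemma val2_inj u v x : val2 u x -> val2 v x -> u = v.
Proof.
by move=> ux vx; case: (ltngtP u v) => // uv;
  [have := val2_lt uv vx (val2W ux)|have := val2_lt uv ux (val2W vx)].
Qed.

Lemma val2_ge_int (a : int) : val2_ge 0 (a%:~R : R).
Proof. by exists a, 0%N; rewrite !mulr1. Qed.

Lemma val2_neq0 v x : val2 v x -> x <> 0.
Proof.
by move=> [a [b +]] x0; rewrite x0 !mul0r => /esym/eqP; rewrite intr_eq0 => /eqP; lia.
Qed.

(** The term with the largest denominator exponent dominates, so the sum has negative valuation,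
    whereas 1 is an integer. *)
Lemma sum_val2_neq1 n (w : 'I_n.+1 -> R) (s : 'I_n.+1 -> nat) :
  injective s -> (forall i, val2 (s i).+1 (w i)) -> \sum_i w i <> 1.
Proof.
move=> sinj ws; pose m := [arg max_(i > ord0) s i].
have mmax i : (s i <= s m)%N by rewrite /m; case: arg_maxnP => // j _; apply.
rewrite (bigD1 m)//= => w1.
suff : val2 (s m).+1 (1 : R) by move=> /(@val2_lt 0); apply => //; exact: (val2_ge_int 1).
rewrite -w1; apply: (@val2D (s m)) => //; elim/big_ind: _ => [|x y|i im].
- by apply: val2_ge_le (val2_ge_int 0).
- exact: val2_geD.
- apply: val2_ge_le (val2W (ws i)); rewrite ltn_neqAle mmax andbT.
  by apply: contra im => /eqP/sinj ->.
Qed.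

Definition enum_val2 (v m : nat) : R :=
  let: (a, b) := odflt (0, 0%N) (unpickle m : option (int * nat)) in
  (a *+ 2 + 1)%:~R / (b.*2.+1%:R * 2 ^+ v).

Lemma enum_val2P v m : val2 v (enum_val2 v m).
Proof.
rewrite /enum_val2; case: (odflt _ _) => a b; exists a, b.
by rewrite -mulrA divfK// mulf_neq0 ?pnatr_eq0// expf_neq0.
Qed.

Lemma enum_val2_dense v (a b : R) : a < b -> exists m, a < enum_val2 v m < b.
Proof.
(* The denominator [D] is so large that consecutive fractions with odd numerators, at distance
   [2 / D], cannot jump over the interval. The numerator is the first odd integer above [a * D]. *)
move=> ab; pose c := Num.truncn (2 / (b - a)).
pose D : R := c.+1.*2.+1%:R * 2 ^+ v.
have D0 : 0 < D by rewrite mulr_gt0 ?exprn_gt0.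
have Dc : 2 < (b - a) * D.
  rewrite mulrC -ltr_pdivrMr ?subr_gt0//; apply: (lt_le_trans (truncnS_gt _)).
  apply: (@le_trans _ _ (c.+1.*2.+1%:R)); first by rewrite ler_nat -addnn -addnS leq_addr.
  by rewrite ler_peMr// exprn_ege1// ler1n.
pose z := (a * D - 1) / 2.
exists (pickle (Num.floor z + 1, c.+1)); rewrite /enum_val2 pickleK /= -/D.
rewrite ltr_pdivlMr// ltr_pdivrMr//.
have /andP[] := Num.Theory.floor_itv z.
rewrite !intrD /z; lra.
Qed.

(** A number has at most one valuation, so different valuations occur at different indices. This
    bounds how many of the dense sets one family can meet. *)
Lemma val2_injection (F : finType) (x : F -> R) k :
  (forall j : 'I_k, exists f, val2 j.+1 (x f)) ->
  exists2 phi : 'I_k -> F, injective phi & forall j : 'I_k, val2 j.+1 (x (phi j)).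
Proof.
move=> /choice[phi phiP]; exists phi => // i j ij; apply/val_inj/succn_inj.
by apply: (val2_inj (phiP i)); rewrite ij; exact: phiP.
Qed.

End two_adic.

(** * Unordered pairs of points *)

Definition opairs n : {set 'I_n * 'I_n} := [set ij : 'I_n * 'I_n | (ij.1 < ij.2)%N].

Lemma card_opairs n : #|opairs n| = ((n * (n - 1)) %/ 2)%N.
Proof.
rewrite subn1 divn2 -bin2 -triangular_sum -sum1_card big_mkord.
rewrite (eq_bigl (fun ij : 'I_n * 'I_n => xpredT ij.2 && (ij.1 < ij.2)%N)); last first.
  by move=> ij; rewrite inE.
rewrite -(pair_big_dep xpredT (fun i j : 'I_n => (i < j)%N) (fun _ _ => 1%N))/=.
rewrite (exchange_big_dep xpredT)//=; apply: eq_bigr => j _.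
rewrite -(big_ord_widen n (fun=> 1%N) (ltnW (ltn_ord j))).
by rewrite sum_nat_const card_ord muln1.
Qed.

Definition sort_pair n (i j : 'I_n) : 'I_n * 'I_n := if (i < j)%N then (i, j) else (j, i).

Lemma sort_pairC n (i j : 'I_n) : sort_pair i j = sort_pair j i.
Proof.
by rewrite /sort_pair; case: ltngtP => // /val_inj ->.
Qed.

Lemma sort_pair_opairs n (i j : 'I_n) : i != j -> sort_pair i j \in opairs n.
Proof. by rewrite /sort_pair -val_eqE/=; case: ltngtP => //= ij _; rewrite inE. Qed.

(* The corners of the face [t e = b] of the unit cube. *)
Section cube_faces.
Variables (R : realType) (N : nat).

Definition face_lo (e : 'I_N) (b : bool) (e' : 'I_N) : R := if e' == e then b%:R else 0.

Definition face_hi (e : 'I_N) (b : bool) (e' : 'I_N) : R := if e' == e then b%:R else 1.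

Lemma face_lo01 e b e' : 0 <= face_lo e b e' <= 1.
Proof. by rewrite /face_lo; case: ifP => _; case: b; rewrite ?lexx ?ler01. Qed.

Lemma face_hi01 e b e' : 0 <= face_hi e b e' <= 1.
Proof. by rewrite /face_hi; case: ifP => _; case: b; rewrite ?lexx ?ler01. Qed.

Lemma face_itv (t : 'I_N -> R) e (b : bool) e' : 0 <= t e' <= 1 -> t e = b%:R ->
  face_lo e b e' <= t e' <= face_hi e b e'.
Proof. by rewrite /face_lo /face_hi; case: eqP => [->|//] _ ->; rewrite lexx. Qed.

End cube_faces.

(** * Model metrics parametrised by a cube *)

Section model_metric.
Variables (R : realType) (n : nat).
Local Notation N := #|opairs n|.

(* The distances of the model spaces lie in [1, 2], which makes the triangle
   inequality automatic, and those of different pairs lie in disjoint intervals. *)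
Definition pair_value (e : 'I_N) (t : R) : R := 1 + (e%:R + e%:R + t) / (N%:R + N%:R).

Definition model_dist (t : 'I_N -> R) (i j : 'I_n) : R :=
  if [pick e | enum_val e == sort_pair i j] is Some e then pair_value e (t e) else 0.

Lemma model_dist_xx t i : model_dist t i i = 0.
Proof.
rewrite /model_dist; case: pickP => // e /eqP ei.
by have := enum_valP e; rewrite ei inE /sort_pair ltnn/= ltnn.
Qed.

Lemma model_dist_sym t i j : model_dist t i j = model_dist t j i.
Proof. by rewrite /model_dist sort_pairC. Qed.

Lemma model_distE i j : i != j -> exists2 e : 'I_N, enum_val e = sort_pair i j &
  forall t, model_dist t i j = pair_value e (t e).
Proof.
move=> ij; rewrite /model_dist; case: pickP => [e /eqP ee|H]; first by exists e.
have := H (enum_rank_in (sort_pair_opairs ij) (sort_pair i j)).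
by rewrite enum_rankK_in ?eqxx// sort_pair_opairs.
Qed.

Lemma model_dist_enum t (e : 'I_N) :
  model_dist t (enum_val e).1 (enum_val e).2 = pair_value e (t e).
Proof.
have := enum_valP e; rewrite inE => e12.
have [|e' + ->] := @model_distE (enum_val e).1 (enum_val e).2.
  by rewrite -val_eqE/= ltn_eqF.
by rewrite /sort_pair e12 -surjective_pairing => /enum_val_inj ->.
Qed.

Lemma N_gt0 (e : 'I_N) : 0 < N%:R :> R.
Proof. by rewrite ltr0n (leq_ltn_trans _ (ltn_ord e)). Qed.

Lemma pair_value_le (e e' : 'I_N) (s t : R) : 0 <= s -> t <= 1 ->
  pair_value e s <= pair_value e' t -> (e <= e')%N.
Proof.
move=> s0 t1; have N0 := N_gt0 e.
rewrite lerD2l ler_pM2r ?invr_gt0 ?addr_gt0// => h.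
have : e%:R < e'%:R + 1 :> R by lra.
by rewrite natr1 ltr_nat ltnS.
Qed.

Lemma pair_value_homo (e : 'I_N) (s t : R) : (pair_value e s <= pair_value e t) = (s <= t).
Proof. by rewrite lerD2l ler_pM2r ?invr_gt0 ?addr_gt0 ?(N_gt0 e)// lerD2l. Qed.

Lemma model_dist_itv t i j : (forall e, 0 <= t e <= 1) -> i != j ->
  1 <= model_dist t i j <= 2.
Proof.
move=> t01 /model_distE[e _ ->]; have N0 := N_gt0 e.
have /andP[t0 t1] := t01 e; rewrite lerDl divr_ge0 ?addr_ge0 ?ler0n//=.
rewrite -lerBrDl ler_pdivrMr ?addr_gt0//.
have : (e.+1%:R <= N%:R :> R) by rewrite ler_nat.
by rewrite -natr1; lra.
Qed.

Lemma model_dist_lip d t s i j : 0 < d -> (forall e, `|t e - s e| < d) ->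
  `|model_dist t i j - model_dist s i j| < d.
Proof.
move=> d0 ts; rewrite /model_dist; case: pickP => [e _|_]; last by rewrite subrr normr0.
have N1 : 1 <= N%:R :> R by rewrite ler1n (leq_ltn_trans _ (ltn_ord e)).
rewrite /pair_value opprD addrACA subrr add0r -mulrBl.
have -> : e%:R + e%:R + t e - (e%:R + e%:R + s e) = t e - s e by lra.
rewrite normrM [X in _ * X]ger0_norm ?invr_ge0 ?addr_ge0 ?ler0n//.
apply: le_lt_trans (ts e); rewrite ler_piMr//.
by rewrite invf_le1 ?addr_gt0 ?(N_gt0 e)//; lra.
Qed.

(* Ordering of the intervals forces a relabelling between two boxes to preserve pairs. *)
Lemma model_dist_rigid (e : 'I_N) (x : 'I_n * 'I_n -> R) (lo hi t : 'I_N -> R) (g : 'S_n) :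
  (forall e, 0 <= lo e) -> (forall e, hi e <= 1) -> (forall e, 0 <= t e <= 1) ->
  (forall i j, model_dist lo i j <= x (i, j) <= model_dist hi i j) ->
  x (g (enum_val e).1, g (enum_val e).2) = pair_value e (t e) -> lo e <= t e <= hi e.
Proof.
move=> lo0 hi1 t01 xb xe; have := enum_valP e; rewrite inE => e12.
have := xb (g (enum_val e).1) (g (enum_val e).2); rewrite xe.
have [|e' _ eE] := @model_distE (g (enum_val e).1) (g (enum_val e).2).
  by rewrite (inj_eq perm_inj) -val_eqE/= ltn_eqF.
have /andP[t0 t1] := t01 e.
rewrite !eE => /andP[l1 l2].
have e'e := pair_value_le (lo0 _) t1 l1; have ee' := pair_value_le t0 (hi1 _) l2.
have E : e' = e by apply/val_inj/eqP; rewrite eqn_leq e'e.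
by move: l1 l2; rewrite E !pair_value_homo => -> ->.
Qed.

End model_metric.

(** * Labelled finite metric spaces *)

Section labellings.
Variable R : realType.
Implicit Types X Y : neMetric R.

Definition labelling (X : Type) n (h : 'I_n -> X) :=
  injective h /\ forall x, exists i, h i = x.

Lemma has_pointsP X n : has_points X n <-> exists h : 'I_n -> X, labelling h.
Proof.
rewrite /has_points (card_eqr card_II) card_eq_sym; split.
  move=> /card_set_bijP[h [_ hi hs]]; exists h; split.
    by move=> i j; apply: hi; rewrite inE.
  by move=> x; have [i _] := hs x I; exists i.
move=> [h [hi hs]]; apply/card_set_bijP; exists h; split => //.
  by move=> i j _ _; exact: hi.
by move=> x _; have [i] := hs x; exists i.
Qed.

Lemma labelling_perm (X : Type) n (h h' : 'I_n -> X) : labelling h -> injective h' ->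
  exists s : 'S_n, h' = h \o s.
Proof.
move=> [_ hs] hi'; have /choice[s sP] : forall i, exists j, h j = h' i by move=> i; exact: hs.
have si : injective s by move=> i j; move/(congr1 h); rewrite !sP => /hi'.
by exists (perm si); apply/funext => i; rewrite /= permE sP.
Qed.

Lemma labelling_comp (X : Type) n (h : 'I_n -> X) (s : 'S_n) : labelling h -> labelling (h \o s).
Proof.
move=> [hi hs]; split=> [i j /hi/perm_inj//|x].
by have [i <-] := hs x; exists (s^-1%g i); rewrite /= permKV.
Qed.

Lemma labelling_inj (X : Type) n (h h' : 'I_n -> X) :
  labelling h -> injective h' -> labelling h'.
Proof. by move=> hl hi; have [s ->] := labelling_perm hl hi; exact: labelling_comp. Qed.

Definition label_dist X n (h : 'I_n -> X) (ij : 'I_n * 'I_n) : R := mdist (h ij.1) (h ij.2).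

Definition relabel n (s : 'S_n) (ij : 'I_n * 'I_n) := (s ij.1, s ij.2).

Lemma label_dist_gap X n (h : 'I_n -> X) : injective h ->
  exists2 r, 0 < r & forall i j, i != j -> r <= mdist (h i) (h j).
Proof.
move=> hi; have [|r r0 rP] := @finite_lower_bound R ('I_n * 'I_n)%type
  (fun ij => if ij.1 == ij.2 then 1 else label_dist h ij).
  by move=> [i j] /=; case: eqVneq => // ij; rewrite mdist_gt0 (inj_eq hi).
by exists r => // i j ij; have := rP (i, j); rewrite /= (negbTE ij).
Qed.

Lemma label_dist_opairs X n (h : 'I_n -> X) ij : label_dist h ij <> 0 ->
  exists e : 'I_#|opairs n|, label_dist h (enum_val e) = label_dist h ij.
Proof.
move=> h0; have ij12 : ij.1 != ij.2.
  by apply/eqP => e; apply: h0; rewrite /label_dist e mdistxx.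
exists (enum_rank_in (sort_pair_opairs ij12) (sort_pair ij.1 ij.2)).
rewrite enum_rankK_in ?sort_pair_opairs// /sort_pair; case: ifP => // _.
exact: metric_sym.
Qed.

Section matching.
Variables (X Y : neMetric R) (n : nat) (h : 'I_n -> X) (S : set (X * Y)) (r : R).
Hypothesis gap : forall i j, i != j -> r <= mdist (h i) (h j).
Hypothesis S_dist : forall p q, S p -> S q -> `|mdist p.1 q.1 - mdist p.2 q.2| < r.

Lemma matching_uniq i j y : S (h i, y) -> S (h j, y) -> i = j.
Proof.
move=> Si Sj; apply/eqP/negP => /negP/gap; rewrite leNgt => /negP[].
by have := S_dist Si Sj; rewrite /= mdistxx subr0 ger0_norm// mdist_ge0.
Qed.

(** Distortion below the gap prevents two labels from sharing a partner, so choosing partners is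
    injective; both spaces having [n] points, it is a labelling of [Y], and then no other partners
    are possible. *)
Lemma matching : has_points Y n -> (forall i, exists y, S (h i, y)) ->
  exists h' : 'I_n -> Y, [/\ labelling h', forall i, S (h i, h' i) &
    forall i y, S (h i, y) -> y = h' i].
Proof.
move=> /has_pointsP[h0 h0P] /choice[h' h'P].
have h'i : injective h'.
  by move=> i j e; apply: (matching_uniq (h'P i)); rewrite e.
have h'l := labelling_inj h0P h'i.
exists h'; split=> // i y Sy; have [j jy] := h'l.2 y.
by rewrite -jy; congr h'; apply: matching_uniq (h'P j) _; rewrite jy.
Qed.

End matching.

Lemma distortion_ge0 X Y (S : set (X * Y)) : (0 <= distortion S)%E.
Proof. by apply: ereal_sup_ubound; left. Qed.

Lemma distortion_lt X Y (S : set (X * Y)) (r : R) : (distortion S < r%:E)%E ->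
  forall p q, S p -> S q -> `|mdist p.1 q.1 - mdist p.2 q.2| < r.
Proof.
move=> Sr p q Sp Sq; rewrite -lte_fin; apply: le_lt_trans Sr.
by apply: ereal_sup_ubound; right; exists p => //; exists q.
Qed.

Definition label_graph X Y n (h : 'I_n -> X) (h' : 'I_n -> Y) : set (X * Y) :=
  [set p | exists i, p = (h i, h' i)].

Lemma label_graph_distortion X Y n (h : 'I_n -> X) (h' : 'I_n -> Y) (r : R) : 0 <= r ->
  (forall ij, `|label_dist h ij - label_dist h' ij| <= r) ->
  (distortion (label_graph h h') <= r%:E)%E.
Proof.
move=> r0 hr; apply: ge_ereal_sup => x [->|[_ [i ->] [_ [j ->] <-]]]; rewrite lee_fin//.
exact: (hr (i, j)).
Qed.

Lemma label_graph_correspondence X Y n (h : 'I_n -> X) (h' : 'I_n -> Y) :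
  labelling h -> labelling h' -> correspondence (label_graph h h').
Proof.
move=> [_ hs] [_ hs']; split=> [x|y].
  by have [i <-] := hs x; exists (h' i), i.
by have [i <-] := hs' y; exists (h i), i.
Qed.

Lemma GH_dist_le X Y n (h : 'I_n -> X) (h' : 'I_n -> Y) (r : R) :
  labelling h -> labelling h' -> 0 <= r ->
  (forall ij, `|label_dist h ij - label_dist h' ij| <= r) -> GH_dist X Y <= r.
Proof.
move=> hl hl' r0 hr; rewrite /GH_dist; set m := ereal_inf _.
have m0 : (0 <= m)%E by apply: le_ereal_inf_tmp => _ [S _ <-]; exact: distortion_ge0.
have mr : (m <= r%:E)%E.
  apply: (le_trans _ (label_graph_distortion r0 hr)); apply: ereal_inf_lbound.
  by exists (label_graph h h') => //; exact: label_graph_correspondence.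
have : fine m <= r.
  by rewrite -lee_fin fineK// ge0_fin_numE// (le_lt_trans mr)// ltry.
by have := fine_ge0 m0; lra.
Qed.

Lemma GH_dist_lt X Y n (r : R) : has_points X n -> has_points Y n -> GH_dist X Y < r ->
  exists2 S : set (X * Y), correspondence S & (distortion S < (r + r)%:E)%E.
Proof.
move=> /has_pointsP[h hl] /has_pointsP[h' hl']; rewrite /GH_dist; set m := ereal_inf _ => mr.
have m0 : (0 <= m)%E by apply: le_ereal_inf_tmp => _ [S _ <-]; exact: distortion_ge0.
(* Since [fine] maps infinite values to 0, the infimum must first be shown finite: a label graph
   bounds it by [M]. *)
pose M := \sum_ij `|label_dist h ij - label_dist h' ij|.
have mM : (m <= M%:E)%E.
  apply: (le_trans _ (label_graph_distortion (h := h) (h' := h') (r := M) _ _)).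
  - apply: ereal_inf_lbound; exists (label_graph h h') => //.
    exact: label_graph_correspondence.
  - by apply: sumr_ge0.
  - by move=> ij; rewrite /M (bigD1 ij)//= lerDl sumr_ge0.
have mfin : m \is a fin_num by rewrite ge0_fin_numE// (le_lt_trans mM)// ltry.
have : (m < (r + r)%:E)%E by rewrite -(fineK mfin) lte_fin; lra.
by move=> /ereal_inf_lt[_ [S cS <-] Sr]; exists S.
Qed.

End labellings.

(** * Metric spaces given by a distance function on labels *)

Section finite_metric.
Variables (R : realType) (n : nat).

Record finite_dist := FiniteDist {
  fdist :> 'I_n.+1 -> 'I_n.+1 -> R;
  fdist_xx : forall i, fdist i i = 0;
  fdist_pos : forall i j, fdist i j = 0 -> i = j;
  fdist_sym : forall i j, fdist i j = fdist j i;
  fdist_tri : forall j i k, fdist i k <= fdist i j + fdist j k }.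

(* The carrier must be a small type: ['I_n.+1] lives in a universe too large for
   [neMetric], contrary to a subset type over [nat]. *)
Definition fdist_space (D : finite_dist) : Set := {i : nat | (i < n.+1)%N}.

Definition fdist_ord (D : finite_dist) (x : fdist_space D) : 'I_n.+1 :=
  Ordinal (proj2_sig x).

Definition fdist_pt (D : finite_dist) (i : 'I_n.+1) : fdist_space D :=
  exist _ (i : nat) (ltn_ord i).

Lemma fdist_ordK D : cancel (@fdist_ord D) (@fdist_pt D).
Proof. by case=> i ip; apply/val_inj. Qed.

Lemma fdist_ptK D : cancel (@fdist_pt D) (@fdist_ord D).
Proof. by move=> i; apply/val_inj. Qed.

Section instances.
Variable D : finite_dist.
Let d (x y : fdist_space D) : R := D (fdist_ord x) (fdist_ord y).

Let d_xx x : d x x = 0. Proof. exact: fdist_xx. Qed.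

Let d_pos x y : d x y = 0 -> x = y.
Proof. by move=> /fdist_pos/(can_inj (@fdist_ordK D)). Qed.

Let d_sym x y : d x y = d y x. Proof. exact: fdist_sym. Qed.

Let d_tri y x z : d x z <= d x y + d y z. Proof. exact: fdist_tri. Qed.

HB.instance Definition _ := Choice.on (fdist_space D).
HB.instance Definition _ := @isMetric.Build R (fdist_space D) d d_xx d_pos d_sym d_tri.

Definition fdist_metric : neMetric R :=
  @NeMetric R (fdist_space D) (Metric.class (fdist_space D)) (fdist_pt D ord0).

Definition fdist_label (i : 'I_n.+1) : fdist_metric := fdist_pt D i.

Lemma fdist_labelling : labelling fdist_label.
Proof.
split=> [|x]; first exact: (can_inj (@fdist_ptK D)).
by exists (@fdist_ord D x); exact: fdist_ordK.
Qed.

Lemma label_dist_fdist ij : label_dist fdist_label ij = D ij.1 ij.2.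
Proof.
by rewrite /label_dist /mdist /= /d !fdist_ptK.
Qed.

Lemma fdist_finite : finite_set [set: fdist_metric].
Proof.
rewrite (_ : [set: _] = fdist_label @` [set: 'I_n.+1]).
  by apply: finite_image; exact: finite_finset.
by apply/seteqP; split=> // x _; have [i <-] := fdist_labelling.2 x; exists i.
Qed.

End instances.

Lemma model_finite_dist (t : 'I_#|opairs n.+1| -> R) : (forall e, 0 <= t e <= 1) ->
  exists D : finite_dist, forall i j, D i j = model_dist t i j.
Proof.
move=> t01; unshelve eexists (@FiniteDist (model_dist t) _ _ _ _) => //.
- exact: model_dist_xx.
- move=> i j e; apply/eqP/negP => /negP ij.
  by have := model_dist_itv t01 ij; rewrite e ler10.
- exact: model_dist_sym.
- move=> j i k; have [->|ij] := eqVneq i j; first by rewrite model_dist_xx add0r.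
  have [->|jk] := eqVneq j k; first by rewrite model_dist_xx addr0.
  have /andP[ij1 ij2] := model_dist_itv t01 ij; have /andP[jk1 jk2] := model_dist_itv t01 jk.
  suff : model_dist t i k <= 2 by lra.
  have [->|ik] := eqVneq i k; first by rewrite model_dist_xx.
  by have /andP[] := model_dist_itv t01 ik.
Qed.

End finite_metric.

(** * The Gromov-Hausdorff space *)

Lemma open_dist_space (R : realType) (T : Type) (d : T -> T -> R) (U : set (dist_space d)) :
  open U <-> dist_open U.
Proof. by []. Qed.

Section GH.
Variables (R : realType) (n : nat).
Local Notation GH := (GH_subspace R n.+1).

Definition GH_coords (c : GH) (x : 'I_n.+1 * 'I_n.+1 -> R) :=
  exists2 h : 'I_n.+1 -> (repr (val c) : compactMetric R), labelling h & x = label_dist h.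

Lemma GH_has_points (c : GH) : has_points (repr (val c) : compactMetric R) n.+1.
Proof. by have := valP c; rewrite inE. Qed.

Lemma GH_coordinate_system :
  coordinate_system (fun s : 'S_n.+1 => relabel s) GH_coords.
Proof.
split.
- move=> c; have [h hl] := (has_pointsP _ _).1 (GH_has_points c).
  by exists (label_dist h), h.
- move=> c x y [h hl ->] [h' hl' ->]; have [s ->] := labelling_perm hl hl'.1.
  by exists s.
- move=> c x s [h hl ->]; exists (h \o s) => //; exact: labelling_comp.
- move=> B oB; apply/open_dist_space => c [_ [h hl ->] Bh]; have [e e0 eB] := oB _ Bh.
  have [m m0 mP] := label_dist_gap hl.1.
  (* The gap [m] makes [matching] applicable and [e] controls the coordinates; halving accounts for
     the factor 1/2 in [GH_dist]. *)
  exists (Num.min m e / 2); first by rewrite divr_gt0// lt_min m0.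
  move=> c' /= /(GH_dist_lt (GH_has_points c) (GH_has_points c'))[S [S1 S2]].
  rewrite -splitr => /distortion_lt Sd.
  have SdP p q : S p -> S q -> `|mdist p.1 q.1 - mdist p.2 q.2| < m.
    by move=> Sp Sq; have := Sd p q Sp Sq; rewrite lt_min => /andP[].
  have [h' [hl' Sh' _]] := matching mP SdP (GH_has_points c') (fun i => S1 (h i)).
  exists (label_dist h'); first by exists h'.
  apply: eB => ij; have := Sd _ _ (Sh' ij.1) (Sh' ij.2).
  by rewrite lt_min => /andP[].
- move=> U c _ /open_dist_space oU Uc [h hl ->]; have [e e0 eU] := oU c Uc.
  exists (e / 2); first by rewrite divr_gt0.
  move=> c' _ [h' hl' ->] hh'; apply: eU => /=.
  apply: (@le_lt_trans _ _ (e / 2)); last by lra.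
  apply: (GH_dist_le hl hl'); first by rewrite divr_ge0 ?ltW.
  by move=> ij; rewrite ltW// hh'.
Qed.

Lemma GH_coords_realize (D : finite_dist R n) :
  exists c : GH, GH_coords c (fun ij => D ij.1 ij.2).
Proof.
pose X : compactMetric R := @CompactMetric R (fdist_metric D) (finite_compact (fdist_finite D)).
(* The representative of the class is only isometric to [X], so the labelling is carried along
   [f]. *)
have /asboolP[f [fs fi]] : isometric X (repr (\pi_(GH_class R) X)).
  have : X = repr (\pi_(GH_class R) X) %[mod GH_class R] by rewrite reprK.
  by move=> /eqmodP.
have hl : labelling (f \o @fdist_label _ _ D).
  split=> [i j /= fij|x].
    apply: (fdist_labelling D).1; apply: mdist_positivity.
    by rewrite -fi fij mdistxx.
  have [y <-] := fs x; have [i <-] := (fdist_labelling D).2 y; by exists i.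
have cP : \pi_(GH_class R) X \in @GH_points R n.+1.
  by rewrite inE; apply/has_pointsP; eexists; exact: hl.
exists (exist (fun c => c \in @GH_points R n.+1) _ cP), (f \o @fdist_label _ _ D) => //.
by apply/funext => ij; rewrite -(label_dist_fdist D) /label_dist /= fi.
Qed.

(** A family meeting all [N + 1] dense sets would show [N + 1] valuations. They are attained at
    nonzero distances, hence at distinct unordered pairs, of which there are only [N]. *)
Lemma GH_dim_le : dim_le GH #|opairs n.+1|.
Proof.
pose N := #|opairs n.+1|.
apply: (coord_dim_le GH_coordinate_system (q := fun j : 'I_N.+1 => enum_val2 R j.+1)).
  by move=> j a b; exact: enum_val2_dense.
move=> c _ [h hl ->]; apply: contrapT => /forallNP H.
have [|phi phii _] := @val2_injection R 'I_N
    (fun e => label_dist h (enum_val e)) N.+1.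
  move=> j; have /existsNP[ij /existsNP[m /contrapT hm]] := H j.
  have vm : val2 j.+1 (label_dist h ij) by rewrite hm; exact: enum_val2P.
  have [e he] := label_dist_opairs (val2_neq0 vm).
  by exists e; rewrite he.
by have := leq_card _ phii; rewrite !card_ord ltnn.
Qed.

Lemma GH_dim_ge j : dim_le GH j -> (#|opairs n.+1| <= j)%N.
Proof.
set N := #|opairs n.+1|.
pose P (t : 'I_N -> R) (ij : 'I_n.+1 * 'I_n.+1) := model_dist t ij.1 ij.2.
apply: (@coord_dim_ge _ _ _ _ _ _ GH_coordinate_system j N
  (fun t => P (t ord0)) (fun e b => closed_box (P (face_lo R e b)) (P (face_hi R e b)))).
- move=> t ct; have [D DE] := model_finite_dist ct.
  have [c cD] := GH_coords_realize D; exists c.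
  by rewrite (_ : P _ = fun ij => D ij.1 ij.2)//; apply/funext => ij; rewrite DE.
- by move=> d t s d0 _ _ ts ij; exact: model_dist_lip.
- by move=> e b; exact: closed_box_closed.
- move=> e x g xb xgb.
  (* After relabelling by [g], the pair [e] has the distance of parameter 1, while [x] lies in the
     box of the face of parameter 0; rigidity would give [1 <= 0]. *)
  have : face_lo R e false e <= true%:R <= face_hi R e false e.
    apply: (@model_dist_rigid _ _ e x (face_lo R e false) (face_hi R e false) (fun=> 1) g).
    + by move=> e'; have /andP[] := face_lo01 R e false e'.
    + by move=> e'; have /andP[] := face_hi01 R e false e'.
    + by move=> _; rewrite ler01 lexx.
    + by move=> i i'; exact: (xb (i, i')).
    + apply/eqP; rewrite eq_le; have := xgb (enum_val e); rewrite /P !model_dist_enum.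
      by rewrite /face_lo /face_hi !eqxx /= andbC.
  by rewrite /face_hi eqxx ler10 andbF.
- move=> t e b ct te ij; rewrite /P; have [ii|ij12] := eqVneq ij.1 ij.2.
    by rewrite ii !model_dist_xx lexx.
  have [e' _ E] := model_distE R ij12; rewrite !E !pair_value_homo.
  exact: face_itv.
Qed.

Lemma GH_dim_eq : dim_eq GH #|opairs n.+1|.
Proof. by split; [exact: GH_dim_le|exact: GH_dim_ge]. Qed.

End GH.

(** * Measures on finite spaces *)

(** The common mass of [w i] and [w' i] stays on the diagonal; the excesses are coupled by their
    normalised product. *)
Lemma coupling_weights (R : realType) n (w w' : 'I_n -> R) :
  (forall i, 0 <= w i) -> (forall i, 0 <= w' i) -> \sum_i w i = \sum_i w' i ->
  exists p : 'I_n -> 'I_n -> R, [/\ forall i j, 0 <= p i j,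
    forall i, \sum_j p i j = w i, forall j, \sum_i p i j = w' j &
    forall i, Num.min (w i) (w' i) <= p i i].
Proof.
move=> w0 w'0 ww'; pose m i := Num.min (w i) (w' i).
pose r i := w i - m i; pose r' i := w' i - m i; pose s := \sum_i r i.
have r0 i : 0 <= r i by rewrite subr_ge0 ge_min lexx.
have r'0 i : 0 <= r' i by rewrite subr_ge0 ge_min lexx orbT.
have s0 : 0 <= s by exact: sumr_ge0.
have s' : \sum_i r' i = s by rewrite /s /r /r' !sumrB ww'.
(* If [s = 0], then [s / s] is 0, but every excess vanishes too. *)
have rs i : r i * (s / s) = r i.
  have [s00|sn0] := eqVneq s 0; last by rewrite divff// mulr1.
  rewrite (_ : r i = 0) ?mul0r//; apply/eqP; rewrite eq_le r0 andbT -s00.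
  by rewrite /s (bigD1 i)//= lerDl sumr_ge0.
have r's i : r' i * (s / s) = r' i.
  have [s00|sn0] := eqVneq s 0; last by rewrite divff// mulr1.
  rewrite (_ : r' i = 0) ?mul0r//; apply/eqP; rewrite eq_le r'0 andbT -s00 -s'.
  by rewrite (bigD1 i)//= lerDl sumr_ge0.
have mE i : \sum_j (if i == j then m i else 0) = m i.
  by rewrite -big_mkcond/= (big_pred1 i)// => j; rewrite eq_sym.
have mE' j : \sum_i (if i == j then m i else 0) = m j.
  by rewrite -big_mkcond/= big_pred1_eq.
exists (fun i j => (if i == j then m i else 0) + r i * (r' j / s)); split.
- move=> i j; rewrite addr_ge0 ?(mulr_ge0 (r0 i) (mulr_ge0 (r'0 j) _)) ?invr_ge0//.
  by case: ifP => // _; rewrite /m le_min w0 w'0.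
- move=> i; rewrite big_split/= mE -mulr_sumr -mulr_suml s' rs /r; lra.
- move=> j; rewrite big_split/= mE' -mulr_suml -/s mulrCA r's /r'; lra.
- by move=> i; rewrite eqxx lerDl !mulr_ge0 ?invr_ge0.
Qed.

Section discrete_measure.
Variables (R : realType) (d : measure_display) (T : measurableType d).

Lemma discrete_measure (F : finType) (f0 : F) (a : F -> T) (w : F -> R) :
  (forall f, 0 <= w f) -> exists m : {measure set T -> \bar R},
    forall A, m A = (\sum_f w f * (a f \in A)%:R)%:E.
Proof.
move=> w0; pose u k := nth f0 (enum F) k.
exists (msum (fun k => mscale (NngNum (w0 (u k))) \d_(a (u k))) #|F|) => A.
transitivity (\sum_(k < #|F|) (w (u k) * (a (u k) \in A)%:R)%:E)%E.
  by apply: eq_bigr => k _; rewrite EFinM -diracE.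
by rewrite sumEFin cardE -[in RHS]big_enum (big_nth f0) big_mkord.
Qed.

(** The alias takes the proof of unit mass as an argument so that the probability structure can be
    attached to it. *)
Definition unit_measure (m : {measure set T -> \bar R}) (m1 : m setT = 1%E) :
  set T -> \bar R := m.

HB.instance Definition _ m m1 := Measure.copy (@unit_measure m m1) m.
HB.instance Definition _ m m1 := Measure_isProbability.Build d T R (@unit_measure m m1) m1.

Lemma probability_of_measure (m : {measure set T -> \bar R}) : m setT = 1%E ->
  exists P : probability T R, forall A, P A = m A.
Proof. by move=> m1; exists (unit_measure m1). Qed.

(** The part of [A] outside [S] has mass at most [1 - m S]. For a coupling, this turns inclusions
    valid on [S] into inequalities between weights. *)
Lemma le_measure_mod (m : {measure set T -> \bar R}) (A B S : set T) : m setT = 1%E ->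
  measurable A -> measurable B -> measurable S -> A `&` S `<=` B ->
  (m A <= m B + (1 - m S))%E.
Proof.
move=> m1 mA mB mS AB.
have mfin C : measurable C -> m C \is a fin_num.
  move=> mC; rewrite ge0_fin_numE ?measure_ge0//; apply: (@le_lt_trans _ _ 1%E); rewrite ?ltry//.
  by rewrite -m1; apply: le_measure; rewrite ?inE.
rewrite (measureDI m mA mS) addeC; apply: leeD.
  by apply: le_measure; rewrite ?inE//; exact: measurableI.
have mAS : measurable (A `\` S) by exact: measurableD.
have dis : (A `\` S) `&` S = set0 by rewrite -subset0 => x [[]].
rewrite leeBrDr ?mfin// -m1 -measureU//.
by apply: le_measure; rewrite ?inE//; exact: measurableU.
Qed.

End discrete_measure.

Lemma finite_closed (T : topologicalType) : finite_set [set: T] ->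
  (forall x : T, closed [set x]) -> forall A : set T, closed A.
Proof.
move=> Tfin T1 A; rewrite (_ : A = \bigcup_(x in A) [set x]).
  by apply: closed_bigcup => //; exact: sub_finite_set Tfin.
by apply/seteqP; split=> [x Ax|x [y Ay ->]//]; exists x.
Qed.

Lemma closed_borel (T : ptopologicalType) (A : set T) : closed A -> measurable (A : set (borel T)).
Proof.
move=> cA; rewrite -[A]setCK; apply: measurableC; apply: sub_sigma_algebra.
by rewrite /= openC.
Qed.

Section labelled_measure.
Variables (R : realType) (X : neMetric R) (n : nat) (h : 'I_n -> X).
Hypothesis hl : labelling h.

Lemma labelled_finite : finite_set [set: X].
Proof.
rewrite (_ : [set: X] = h @` [set: 'I_n]).
  by apply: finite_image; exact: finite_finset.
by apply/seteqP; split=> // x _; have [i <-] := hl.2 x; exists i.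
Qed.

Lemma labelled_closed (A : set X) : closed A.
Proof.
apply: finite_closed; first exact: labelled_finite.
by move=> x; apply: accessible_closed_set1; apply: hausdorff_accessible; exact: metric_hausdorff.
Qed.

Lemma labelled_measurable (A : set (borel X)) : measurable A.
Proof. by apply: (@closed_borel X A); exact: labelled_closed. Qed.

Lemma labelled_measureE (mu : {measure set (borel X) -> \bar R}) (A : set (borel X)) :
  mu A = (\sum_i mu [set h i] * ((h i \in A)%:R)%:E)%E.
Proof.
suff E (s : seq 'I_n) : uniq s ->
    mu [set x | A x /\ exists2 i, i \in s & h i = x] =
    (\sum_(i <- s) mu [set h i] * ((h i \in A)%:R)%:E)%E.
  rewrite -E ?index_enum_uniq//; congr (mu _); apply/seteqP; split=> [x Ax|x []//].
  by split=> //; have [i hx] := hl.2 x; exists i => //; rewrite mem_index_enum.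
elim: s => [_|i s IH /= /andP[si /IH {}IH]].
  by rewrite big_nil (_ : [set _ | _] = set0) ?measure0// -subset0 => x [_ []].
rewrite big_cons -IH.
rewrite (_ : [set x | A x /\ _] = (if h i \in A then [set h i] else set0) `|`
    [set x | A x /\ exists2 i, i \in s & h i = x]); last first.
  apply/seteqP; split=> x /=.
    move=> [Ax [j]]; rewrite inE => /predU1P[->|js] jx; last by right; split=> //; exists j.
    by left; rewrite jx mem_set.
  case=> [|[Ax [j js jx]]]; last by split=> //; exists j => //; rewrite inE js orbT.
  case: ifPn => // /set_mem Ah ->; split=> //; exists i => //; exact: mem_head.
rewrite measureU; [|exact: labelled_measurable|exact: labelled_measurable|].
  by congr (_ + _)%E; case: ifP => _; rewrite ?mule1// mule0 measure0.
rewrite -subset0 => x []; case: ifP => // _ -> [_ [j js /hl.1 ji]].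
by move: si; rewrite -ji js.
Qed.

End labelled_measure.

(** * Labelled finite metric measure spaces *)

Section labelled_mm.
Variables (R : realType) (X : mmSpace R) (n : nat) (h : 'I_n -> X).
Hypothesis hl : labelling h.

Definition label_weight (i : 'I_n) : R := fine (mm_measure X [set h i]).

Lemma label_weightE i : mm_measure X [set h i] = (label_weight i)%:E.
Proof. by rewrite fineK// fin_num_measure//; exact: (labelled_measurable hl). Qed.

Lemma mm_measureE (A : set (borel X)) :
  mm_measure X A = (\sum_i label_weight i * (h i \in A)%:R)%:E.
Proof.
rewrite (labelled_measureE hl) -sumEFin; apply: eq_bigr => i _.
by rewrite EFinM -label_weightE.
Qed.

Lemma sum_label_weight : \sum_i label_weight i = 1.
Proof.
have /eqP := mm_measureE setT; rewrite probability_setT eqe => /eqP ->.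
by apply: eq_bigr => i _; rewrite in_setT mulr1.
Qed.

Lemma label_weight_gt0 i : 0 < label_weight i.
Proof.
rewrite -lte_fin -label_weightE.
have : Defs.support (mm_measure X) (h i) by rewrite mm_support.
apply=> //; rewrite -[[set h i]]setCK openC; exact: (labelled_closed hl).
Qed.

End labelled_mm.

(** * Box distance between labelled spaces *)

Section box_distance.
Variable R : realType.
Implicit Types X Y : mmSpace R.

Definition box_inf X Y : \bar R := ereal_inf [set
  ereal_inf [set maxe (1 - pi S)%E (distortion S) | S in @closed (X * Y)%type]
  | pi in @coupling R X Y].

Lemma box_inf_ge0 X Y : (0 <= box_inf X Y)%E.
Proof.
apply: le_ereal_inf_tmp => _ [pi _ <-]; apply: le_ereal_inf_tmp => _ [S _ <-].
by rewrite le_max distortion_ge0 orbT.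
Qed.

Section labelled_pair.
Variables (X Y : mmSpace R) (n : nat) (h : 'I_n.+1 -> X) (h' : 'I_n.+1 -> Y).
Hypotheses (hl : labelling h) (hl' : labelling h').

Lemma label_graph_closed : closed (label_graph h h').
Proof.
rewrite (_ : label_graph h h' = \bigcup_(i in [set: 'I_n.+1])
    (fst @^-1` [set h i] `&` snd @^-1` [set h' i])).
  apply: closed_bigcup; first exact: finite_finset.
  move=> i _; apply: closedI; apply: preimage_closed.
  - by move=> p _; exact: cvg_fst.
  - exact: (labelled_closed hl).
  - by move=> p _; exact: cvg_snd.
  - exact: (labelled_closed hl').
apply/seteqP; split=> [_ [i ->]|[x y] [i _ [/= -> ->]]]; first by exists i.
by exists i.
Qed.

(** The coupling puts at least [label_weight h i - r] on each pair [(h i, h' i)], so the label graph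
    misses mass at most [(n + 1) r], and its distortion is at most [r]. *)
Lemma box_inf_le (r : R) : 0 <= r ->
  (forall ij, `|label_dist h ij - label_dist h' ij| <= r) ->
  (forall i, `|label_weight h i - label_weight h' i| <= r) ->
  (box_inf X Y <= (n.+1%:R * r)%:E)%E.
Proof.
move=> r0 hd hw.
have [|||p [p0 pw pw' pm]] := @coupling_weights R _ (label_weight h) (label_weight h').
- by move=> i; rewrite ltW// label_weight_gt0.
- by move=> i; rewrite ltW// label_weight_gt0.
- by rewrite !sum_label_weight.
have [m mE] := @discrete_measure R _ (borel (X * Y)%type) ('I_n.+1 * 'I_n.+1)%type (ord0, ord0)
  (fun ij => (h ij.1, h' ij.2)) (fun ij => p ij.1 ij.2) (fun ij => p0 ij.1 ij.2).
apply: (@le_trans _ _ (maxe (1 - m (label_graph h h')) (distortion (label_graph h h')))%E).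
  apply: (@le_trans _ _ (ereal_inf [set maxe (1 - m S)%E (distortion S) | S in @closed (X * Y)%type])).
    apply: ereal_inf_lbound; exists m => //; split=> [A _|B _].
      rewrite mE (mm_measureE hl); congr (_%:E).
      rewrite -(pair_bigA _ (fun i j => p i j * ((h i, h' j) \in fst @^-1` A)%:R))/=.
      apply: eq_bigr => i _; rewrite -pw mulr_suml; apply: eq_bigr => j _.
      by [].
    rewrite mE (mm_measureE hl'); congr (_%:E).
    rewrite -(pair_bigA _ (fun i j => p i j * ((h i, h' j) \in snd @^-1` B)%:R))/=.
    rewrite exchange_big; apply: eq_bigr => j _; rewrite -pw' mulr_suml; apply: eq_bigr => i _.
    by [].
  by apply: ereal_inf_lbound; exists (label_graph h h') => //; exact: label_graph_closed.
rewrite ge_max; apply/andP; split; last first.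
  apply: (le_trans (label_graph_distortion r0 hd)).
  by rewrite lee_fin ler_peMl// ler1n.
rewrite mE -EFinB lee_fin lerBlDr -lerBlDl.
rewrite -(pair_bigA _ (fun i j => p i j * ((h i, h' j) \in label_graph h h')%:R))/=.
apply: (@le_trans _ _ (\sum_i (label_weight h i - r))).
  by rewrite sumrB (sum_label_weight hl) sumr_const card_ord mulr_natl lexx.
apply: ler_sum => i _; rewrite (bigD1 i)//= mem_set; last by exists i.
rewrite mulr1 ler_wpDr//; first by apply: sumr_ge0 => j _; rewrite mulr_ge0.
apply: le_trans (pm i); have := hw i; rewrite ler_norml le_min => /andP[]; lra.
Qed.

Lemma box_dist_le (r : R) : 0 <= r ->
  (forall ij, `|label_dist h ij - label_dist h' ij| <= r) ->
  (forall i, `|label_weight h i - label_weight h' i| <= r) ->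
  box_dist X Y <= n.+1%:R * r.
Proof.
move=> r0 hd hw; have le := box_inf_le r0 hd hw.
by rewrite -lee_fin fineK// ge0_fin_numE ?box_inf_ge0// (le_lt_trans le)// ltry.
Qed.

Lemma box_inf_fin : box_inf X Y \is a fin_num.
Proof.
pose r := \sum_ij `|label_dist h ij - label_dist h' ij| +
  \sum_i `|label_weight h i - label_weight h' i|.
have r0 : 0 <= r by rewrite addr_ge0// sumr_ge0.
rewrite ge0_fin_numE ?box_inf_ge0//; apply: le_lt_trans (box_inf_le r0 _ _) _; last exact: ltry.
- by move=> ij; rewrite /r (bigD1 ij)//= -addrA lerDl addr_ge0 ?sumr_ge0.
- by move=> i; rewrite /r [leRHS]addrC (bigD1 i)//= -addrA lerDl addr_ge0 ?sumr_ge0.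
Qed.

End labelled_pair.

Lemma box_dist_lt X Y n (r : R) : has_points X n.+1 -> has_points Y n.+1 -> box_dist X Y < r ->
  exists pi, coupling (X := X) (Y := Y) pi /\ exists S : set (X * Y),
    [/\ closed S, (1 - pi S < r%:E)%E & (distortion S < r%:E)%E].
Proof.
move=> /has_pointsP[h hl] /has_pointsP[h' hl'].
rewrite -lte_fin fineK; last exact: box_inf_fin hl hl'.
move=> /ereal_inf_lt[_ [pi cpi <-]] /ereal_inf_lt[_ [S cS <-]].
by rewrite gt_max => /andP[S1 S2]; exists pi; split=> //; exists S.
Qed.

End box_distance.

(** * The box space *)

Section mm_realization.
Variables (R : realType) (n : nat).

Lemma mm_isometry_label (X Y : mmSpace R) (f : X -> Y) (h : 'I_n -> X) :
  mm_isometry f -> labelling h ->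
  [/\ labelling (f \o h), label_dist (f \o h) = label_dist h &
     forall i, label_weight (f \o h) i = label_weight h i].
Proof.
move=> [[fs fi] fmu] hl.
have finj : injective f.
  by move=> x y fxy; apply: mdist_positivity; rewrite -fi fxy mdistxx.
have fhl : labelling (f \o h).
  split=> [i j /= /finj/hl.1//|y].
  by have [x <-] := fs y; have [i <-] := hl.2 x; exists i.
split=> // [|i]; first by apply/funext => ij; exact: fi.
rewrite /label_weight -fmu; last exact: (labelled_measurable fhl).
by congr (fine (mm_measure X _)); apply/seteqP; split=> [x /= /finj|x /= ->].
Qed.

Lemma mm_realize (D : finite_dist R n) (w : 'I_n.+1 -> R) :
  (forall i, 0 < w i) -> \sum_i w i = 1 ->
  exists (X : mmSpace R) (h : 'I_n.+1 -> X), [/\ labelling h,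
    forall ij, label_dist h ij = D ij.1 ij.2 & forall i, label_weight h i = w i].
Proof.
move=> w0 w1; pose X := fdist_metric D; pose h : 'I_n.+1 -> X := @fdist_label _ _ D.
have hl : labelling h := fdist_labelling D.
have [m mE] := @discrete_measure R _ (borel X) 'I_n.+1 ord0 h w (fun i => ltW (w0 i)).
have [|P PE] := @probability_of_measure R _ (borel X) m.
  rewrite mE; congr (_%:E); rewrite -[RHS]w1; apply: eq_bigr => i _.
  by rewrite in_setT mulr1.
have Xc : complete_space X.
  move=> F FF cF; apply: compact_cauchy_cvg (filterT) (finite_compact (labelled_finite hl)) => //.
have Xs : separable X.
  exists setT; first exact/finite_set_countable/(labelled_finite hl).
  by move=> O [x Ox] _; exists x.
have Psupp : Defs.support P = [set: X].
  apply/seteqP; split=> // x _ U oU Ux; have [i hx] := hl.2 x.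
  rewrite PE mE lte_fin (bigD1 i)//= hx mem_set// mulr1 ltr_pwDl//.
  apply: sumr_ge0 => j _; apply: mulr_ge0; [exact: ltW|exact: ler0n].
exists (MMSpace Xc Xs Psupp), h; split=> // [ij|i]; first exact: label_dist_fdist.
rewrite /label_weight /= PE mE /= (bigD1 i)//= mem_set// mulr1 big1 ?addr0// => j ji.
rewrite memNset ?mulr0// => /hl.1 ij; by rewrite ij eqxx in ji.
Qed.

End mm_realization.

Section box.
Variables (R : realType) (n : nat).
Local Notation box := (box_subspace R n.+1).
Local Notation index := ('I_n.+1 * 'I_n.+1 + 'I_n.+1)%type.

Definition label_coords (X : mmSpace R) (h : 'I_n.+1 -> X) (a : index) : R :=
  match a with inl ij => label_dist h ij | inr i => label_weight h i end.

Definition relabel_index (s : 'S_n.+1) (a : index) : index :=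
  match a with inl ij => inl (relabel s ij) | inr i => inr (s i) end.

Definition box_coords (c : box) (x : index -> R) :=
  exists2 h : 'I_n.+1 -> (repr (val c) : mmSpace R), labelling h & x = label_coords h.

Lemma box_has_points (c : box) : has_points (repr (val c) : mmSpace R) n.+1.
Proof. by have := valP c; rewrite inE. Qed.

Lemma label_weight_gap (X : mmSpace R) (h : 'I_n.+1 -> X) : labelling h ->
  exists2 r, 0 < r & forall i, r <= label_weight h i.
Proof. by move=> hl; apply: finite_lower_bound => i; exact: label_weight_gt0. Qed.

(** The mass outside [S] is less than each weight, so every [h i] has a partner in [S], unique by
    the gap. On [S], being over [h i] and being over [h' i] are then equivalent, so the weights
    differ by less than [r]. *)
Lemma box_matching (X Y : mmSpace R) (h : 'I_n.+1 -> X) (r : R) :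
  labelling h -> has_points Y n.+1 ->
  (forall i j, i != j -> r <= mdist (h i) (h j)) -> (forall i, r <= label_weight h i) ->
  box_dist X Y < r -> exists2 h' : 'I_n.+1 -> Y, labelling h' &
  near_coord r (label_coords h) (label_coords h').
Proof.
move=> hl Yn gap wgap /(box_dist_lt ((has_pointsP _ _).2 (ex_intro _ h hl)) Yn).
move=> [pi [[piX piY] [S [cS S1 /distortion_lt Sd]]]].
have mS : measurable (S : set (borel (X * Y)%type)) by exact: closed_borel.
have mX (A : set X) : measurable (fst @^-1` A : set (borel (X * Y)%type)).
  apply: closed_borel; apply: preimage_closed; last exact: (labelled_closed hl).
  by move=> p _; exact: cvg_fst.
have [h0 hl0] := (has_pointsP _ _).1 Yn.
have mY (A : set Y) : measurable (snd @^-1` A : set (borel (X * Y)%type)).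
  apply: closed_borel; apply: preimage_closed; last exact: (labelled_closed hl0).
  by move=> p _; exact: cvg_snd.
have pi1 : pi setT = 1%E.
  by rewrite -(probability_setT (mm_measure X)) -piX// preimage_setT.
have piXE i : pi (fst @^-1` [set h i]) = (label_weight h i)%:E.
  by rewrite piX ?(label_weightE hl)//; exact: (labelled_measurable hl).
have [|h' [hl' Sh' huniq]] := matching gap Sd Yn.
  move=> i; apply: contrapT => /forallNP noy.
  suff : ((label_weight h i)%:E < r%:E)%E by rewrite lte_fin ltNge wgap.
  apply: le_lt_trans S1; rewrite -piXE -[leRHS]add0e -(measure0 pi).
  apply: le_measure_mod => // -[x y] [/= -> Sy]; exact: (noy y).
have piYE i : pi (snd @^-1` [set h' i]) = (label_weight h' i)%:E.
  by rewrite piY ?(label_weightE hl')//; exact: (labelled_measurable hl').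
exists h' => // -[ij|i] /=; first by have := Sd _ _ (Sh' ij.1) (Sh' ij.2).
have lt1 : label_weight h i < label_weight h' i + r.
  have : (pi (fst @^-1` [set h i]) <= pi (snd @^-1` [set h' i]) + (1 - pi S))%E.
    by apply: le_measure_mod => // -[x y] [/= -> Sy]; exact: huniq.
  rewrite piXE piYE -lte_fin EFinD => /le_lt_trans; apply.
  by rewrite lteD2lE.
have lt2 : label_weight h' i < label_weight h i + r.
  have : (pi (snd @^-1` [set h' i]) <= pi (fst @^-1` [set h i]) + (1 - pi S))%E.
    apply: le_measure_mod => // -[x y] [/= yE Sy]; have [j jx] := hl.2 x.
    by move: Sy; rewrite -jx => /huniq; rewrite yE => /hl'.1 ->.
  rewrite piXE piYE -lte_fin EFinD => /le_lt_trans; apply.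
  by rewrite lteD2lE.
by rewrite ltr_norml; lra.
Qed.

Lemma box_coordinate_system : coordinate_system relabel_index box_coords.
Proof.
split.
- move=> c; have [h hl] := (has_pointsP _ _).1 (box_has_points c).
  by exists (label_coords h), h.
- move=> c x y [h hl ->] [h' hl' ->]; have [s ->] := labelling_perm hl hl'.1.
  by exists s; apply/funext; case.
- move=> c x s [h hl ->]; exists (h \o s); first exact: labelling_comp.
  by apply/funext; case.
- move=> B oB; apply/open_dist_space => c [_ [h hl ->] Bh]; have [e e0 eB] := oB _ Bh.
  have [m m0 mP] := label_dist_gap hl.1; have [m' m'0 m'P] := label_weight_gap hl.
  pose r := Num.min m (Num.min m' e).
  exists r; first by rewrite !lt_min m0 m'0.
  move=> c' /=.
  have rm i j : i != j -> r <= mdist (h i) (h j).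
    by move=> /mP; apply: le_trans; rewrite ge_min lexx.
  have rm' i : r <= label_weight h i.
    by apply: le_trans (m'P i); rewrite !ge_min lexx orbT.
  move=> /(box_matching hl (box_has_points c') rm rm')[h' hl' hh'].
  exists (label_coords h'); first by exists h'.
  by apply: eB => a; apply: lt_le_trans (hh' a) _; rewrite !ge_min lexx !orbT.
- move=> U c _ /open_dist_space oU Uc [h hl ->]; have [e e0 eU] := oU c Uc.
  have N0 : 0 < n.+2%:R :> R by [].
  (* [box_dist_le] loses a factor [n + 1]; dividing by [n + 2] keeps the inequality strict. *)
  exists (e / n.+2%:R); first by rewrite divr_gt0.
  move=> c' _ [h' hl' ->] hh'; apply: eU => /=.
  apply: (@le_lt_trans _ _ (n.+1%:R * (e / n.+2%:R))).
    apply: (box_dist_le hl hl'); first by rewrite divr_ge0 ?ltW.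
      by move=> ij; rewrite ltW// (hh' (inl ij)).
    by move=> i; rewrite ltW// (hh' (inr i)).
  by rewrite mulrCA gtr_pMr// ltr_pdivrMr// mul1r ltr_nat.
Qed.

Lemma box_coords_realize (D : finite_dist R n) (w : 'I_n.+1 -> R) :
  (forall i, 0 < w i) -> \sum_i w i = 1 ->
  exists c : box, box_coords c (fun a => match a with inl ij => D ij.1 ij.2 | inr i => w i end).
Proof.
move=> w0 w1; have [X [h [hl hD hw]]] := mm_realize D w0 w1.
have /asboolP[f fiso] : mm_isomorphic X (repr (\pi_(box_class R) X)).
  have : X = repr (\pi_(box_class R) X) %[mod box_class R] by rewrite reprK.
  by move=> /eqmodP.
have [fhl fhD fhw] := mm_isometry_label fiso hl.
have cP : \pi_(box_class R) X \in @box_points R n.+1.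
  by rewrite inE; apply/has_pointsP; eexists; exact: fhl.
exists (exist (fun c => c \in @box_points R n.+1) _ cP), (f \o h) => //.
by apply/funext => -[ij|i] /=; rewrite ?fhD ?hD ?fhw ?hw.
Qed.

(** Here there are as many coordinates as valuations, namely [N + n + 1]. If all valuations
    occurred, they would match the coordinates bijectively, and the weights, having distinct
    negative valuations, could not sum to 1. *)
Lemma box_dim_le : dim_le box (#|opairs n.+1| + n)%N.
Proof.
set N := #|opairs n.+1|; set k := (N + n)%N.
apply: (coord_dim_le box_coordinate_system (q := fun j : 'I_k.+1 => enum_val2 R j.+1)).
  by move=> j a b; exact: enum_val2_dense.
move=> c _ [h hl ->]; apply: contrapT => /forallNP H.
pose y (a : 'I_N + 'I_n.+1) : R := match a with
  inl e => label_dist h (enum_val e) | inr i => label_weight h i end.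
have [|phi phii phiP] := @val2_injection R _ y k.+1.
  move=> j; have /existsNP[a /existsNP[m /contrapT am]] := H j.
  have vm : val2 j.+1 (label_coords h a) by rewrite am; exact: enum_val2P.
  case: a am vm => [ij|i] _ /= vm; last by exists (inr i).
  by have [e he] := label_dist_opairs (val2_neq0 vm); exists (inl e); rewrite /y he.
have [psi _ psiK] : bijective phi.
  by apply: inj_card_bij phii _; rewrite card_sum !card_ord addnS.
apply: (@sum_val2_neq1 R n (label_weight h) (fun i => psi (inr i))).
- by move=> i j /val_inj/(congr1 phi); rewrite !psiK => -[].
- by move=> i; have := phiP (psi (inr i)); rewrite psiK.
- exact: sum_label_weight.
Qed.

End box.

(** * Model spaces with varying weights *)

Section model_weights.
Variables (R : realType) (n : nat).
(** With this constant each of the first [n] weights is at most [2 n / K], so together they are at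
    most 1/2; also [n < K] makes the last weight 1-Lipschitz. *)
Let K : R := (n.+1 * n.+1 * 4)%:R.

Let K_gt0 : 0 < K. Proof. by rewrite ltr0n. Qed.

(* All weights but the last one range over disjoint intervals in ]0, 1/2[; the
   last one, at least 1/2, is what remains. *)
Definition weight_value (j : 'I_n) (u : R) : R := (j%:R + j%:R + 1 + u) / K.

(** The last entry [a] is the remaining mass for model spaces, and one of the bounds 1/2 and 1 for
    the boxes of the faces. *)
Definition extend_weights (u : 'I_n -> R) (a : R) (i : 'I_n.+1) : R :=
  if unlift ord_max i is Some j then weight_value j (u j) else a.

Lemma extend_weights_lift u a j :
  extend_weights u a (lift ord_max j) = weight_value j (u j).
Proof. by rewrite /extend_weights liftK. Qed.

Lemma extend_weights_max u a : extend_weights u a ord_max = a.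
Proof. by rewrite /extend_weights unlift_none. Qed.

Lemma sum_extend_weights u a :
  \sum_i extend_weights u a i = a + \sum_j weight_value j (u j).
Proof.
rewrite (bigD1_ord ord_max)//= extend_weights_max; congr (_ + _).
by apply: eq_bigr => j _; rewrite extend_weights_lift.
Qed.

Lemma weight_value_gt0 j u : 0 <= u -> 0 < weight_value j u.
Proof.
move=> u0; rewrite divr_gt0//; have : 0 <= j%:R :> R by [].
lra.
Qed.

Lemma weight_value_le j u v : (weight_value j u <= weight_value j v) = (u <= v).
Proof. by rewrite ler_pM2r ?invr_gt0// lerD2l. Qed.

Lemma weight_value_index j j' u v : 0 <= u -> v <= 1 ->
  weight_value j u <= weight_value j' v -> (j <= j')%N.
Proof.
move=> u0 v1; rewrite ler_pM2r ?invr_gt0// => h.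
have : j%:R < j'%:R + 1 :> R by lra.
by rewrite natr1 ltr_nat ltnS.
Qed.

Let wmax : R := (n + n)%:R / K.

Let weight_value_wmax j u : u <= 1 -> weight_value j u <= wmax.
Proof.
move=> u1; rewrite ler_pM2r ?invr_gt0//.
have : j.+1%:R <= n%:R :> R by rewrite ler_nat.
rewrite natrD -natr1; lra.
Qed.

Lemma weight_value_lt_half j u : u <= 1 -> weight_value j u < 2^-1.
Proof.
move=> /(weight_value_wmax j) /le_lt_trans; apply.
rewrite ltr_pdivrMr// mulrC ltr_pdivlMr// -natrM ltr_nat; nia.
Qed.

Lemma sum_weight_value_le_half u : (forall j, u j <= 1) ->
  \sum_j weight_value j (u j) <= 2^-1.
Proof.
move=> u1; apply: (@le_trans _ _ (\sum_(j < n) wmax)).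
  by apply: ler_sum => j _; exact: weight_value_wmax.
rewrite sumr_const card_ord -[wmax *+ n]mulr_natl /wmax mulrA ler_pdivrMr// [leRHS]mulrC ler_pdivlMr//.
by rewrite -!natrM ler_nat; nia.
Qed.

Definition model_weight (u : 'I_n -> R) : 'I_n.+1 -> R :=
  extend_weights u (1 - \sum_j weight_value j (u j)).

Lemma sum_model_weight u : \sum_i model_weight u i = 1.
Proof. by rewrite sum_extend_weights subrK. Qed.

Lemma model_weight_gt0 u i : (forall j, 0 <= u j <= 1) -> 0 < model_weight u i.
Proof.
move=> u01; rewrite /model_weight; case: (unliftP ord_max i) => [j ->|->].
  by rewrite extend_weights_lift weight_value_gt0//; have /andP[] := u01 j.
rewrite extend_weights_max.
have : \sum_j weight_value j (u j) <= 2^-1.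
  by apply: sum_weight_value_le_half => j; have /andP[] := u01 j.
lra.
Qed.

Let weight_value_lip j u v : `|weight_value j u - weight_value j v| = `|u - v| / K.
Proof.
rewrite -mulrBl normrM (gtr0_norm (_ : 0 < K^-1)) ?invr_gt0//; congr (`|_| * _); lra.
Qed.

Lemma model_weight_lip d u v i : 0 < d -> (forall j, `|u j - v j| < d) ->
  `|model_weight u i - model_weight v i| < d.
Proof.
move=> d0 uv; rewrite /model_weight; case: (unliftP ord_max i) => [j ->|->].
  rewrite !extend_weights_lift weight_value_lip ltr_pdivrMr//.
  by apply: lt_le_trans (uv j) _; rewrite ler_peMr ?(ltW d0)// /K ler1n.
rewrite !extend_weights_max distrC opprB addrC addrA subrK -sumrB.
apply: (le_lt_trans (ler_norm_sum _ _ _)).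
apply: (@le_lt_trans _ _ (\sum_(j < n) d / K)).
  by apply: ler_sum => j _; rewrite weight_value_lip ler_pM2r ?invr_gt0// ltW.
rewrite sumr_const card_ord -mulr_natl mulrCA gtr_pMr// ltr_pdivrMr// mul1r ltr_nat; nia.
Qed.

(** A value below 1/2 cannot sit at the last index, so [i] lifts some [j']; the order of the
    disjoint intervals forces [j' = j]. *)
Lemma model_weight_rigid (j : 'I_n) (x : 'I_n.+1 -> R) (u v : 'I_n -> R) t i :
  (forall j, 0 <= u j) -> (forall j, v j <= 1) -> 0 <= t <= 1 ->
  extend_weights u 2^-1 i <= x i <= extend_weights v 1 i ->
  x i = weight_value j t -> u j <= t <= v j.
Proof.
move=> u0 v1 /andP[t0 t1] + xi; rewrite xi.
case: (unliftP ord_max i) => [j' ->|->].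
  rewrite !extend_weights_lift => /andP[l1 l2].
  have j'j := weight_value_index (u0 _) t1 l1; have jj' := weight_value_index t0 (v1 _) l2.
  have E : j' = j by apply/val_inj/eqP; rewrite eqn_leq j'j.
  by move: l1 l2; rewrite E !weight_value_le => -> ->.
by rewrite extend_weights_max leNgt weight_value_lt_half.
Qed.

End model_weights.

(** * Lower bound for the box space *)

Section box_lower_bound.
Variables (R : realType) (n : nat).
Local Notation box := (box_subspace R n.+1).
Local Notation index := ('I_n.+1 * 'I_n.+1 + 'I_n.+1)%type.
Local Notation N := #|opairs n.+1|.

Let coords_of (t : 'I_(N + n) -> R) (w : 'I_n.+1 -> R) (a : index) : R :=
  match a with
  | inl ij => model_dist (t \o lshift n) ij.1 ij.2
  | inr i => w i
  end.

Let face_box (e : 'I_(N + n)) (b : bool) : set (index -> R) :=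
  closed_box
    (coords_of (face_lo R e b) (extend_weights (face_lo R e b \o @rshift N n) 2^-1))
    (coords_of (face_hi R e b) (extend_weights (face_hi R e b \o @rshift N n) 1)).

Lemma box_dim_ge j : dim_le box j -> (N + n <= j)%N.
Proof.
pose P (t : 'rV[R]_(N + n)) := coords_of (t ord0) (model_weight (t ord0 \o @rshift N n)).
apply: (@coord_dim_ge _ _ _ _ _ _ (@box_coordinate_system R n) j (N + n) P face_box).
- move=> t ct; have [|D DE] := @model_finite_dist R n (t ord0 \o lshift n).
    by move=> e; exact: ct.
  have [||c cD] := @box_coords_realize R n D (model_weight (t ord0 \o @rshift N n)).
  + by move=> i; apply: model_weight_gt0 => l; exact: ct.
  + exact: sum_model_weight.
  + exists c; rewrite (_ : P t = fun a => match a with inl ij => D ij.1 ij.2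
      | inr i => model_weight (t ord0 \o @rshift N n) i end)//.
    by apply/funext => -[ij|i] //=; rewrite DE.
- move=> d t s d0 _ _ ts [ij|i] /=.
    by apply: model_dist_lip => // e; exact: ts.
  by apply: model_weight_lip => // e; exact: ts.
- by move=> e b; exact: closed_box_closed.
- move=> e x g xb xgb.
  have lo01 e' := face_lo01 R e false e'; have hi01 e' := face_hi01 R e false e'.
  suff : face_lo R e false e <= true%:R <= face_hi R e false e.
    by rewrite /face_hi eqxx ler10 andbF.
  (* The direction [e] moves either a distance or a weight; in both cases rigidity with parameter 1
     contradicts the face of parameter 0. *)
  case: (split_ordP e) => [e0|i0] E.
  + rewrite [X in face_lo R e false X]E [X in face_hi R e false X]E.
    apply: (@model_dist_rigid _ _ e0 (fun ij => x (inl ij)) (face_lo R e false \o @lshift N n)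
      (face_hi R e false \o @lshift N n) (fun=> 1) g) => //=.
    * by move=> e'; have /andP[] := lo01 (lshift n e').
    * by move=> e'; have /andP[] := hi01 (lshift n e').
    * by move=> _; rewrite ler01 lexx.
    * by move=> i i'; exact: (xb (inl (i, i'))).
    * apply/eqP; rewrite eq_le; have := xgb (inl (enum_val e0)).
      by rewrite /= !model_dist_enum /= E /face_lo /face_hi !eqxx /= andbC.
  + rewrite [X in face_lo R e false X]E [X in face_hi R e false X]E.
    apply: (@model_weight_rigid _ _ i0 (fun i => x (inr i)) (face_lo R e false \o @rshift N n)
      (face_hi R e false \o @rshift N n) 1 (g (lift ord_max i0))) => //=.
    * by move=> e'; have /andP[] := lo01 (rshift N e').
    * by move=> e'; have /andP[] := hi01 (rshift N e').
    * by rewrite ler01 lexx.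
    * exact: (xb (inr (g (lift ord_max i0)))).
    * apply/eqP; rewrite eq_le; have := xgb (inr (lift ord_max i0)).
      by rewrite /= !extend_weights_lift /= E /face_lo /face_hi !eqxx /= andbC.
- move=> t e b ct te [ij|i] /=.
    rewrite /P/=; have [ii|ij12] := eqVneq ij.1 ij.2.
      by rewrite ii !model_dist_xx lexx.
    have [e' _ E'] := model_distE R ij12; rewrite !E' !pair_value_homo.
    exact: face_itv.
  rewrite /P/= /model_weight; case: (unliftP ord_max i) => [l ->|->].
    by rewrite !extend_weights_lift !weight_value_le; exact: face_itv.
  rewrite !extend_weights_max; have ut l : (t ord0 \o @rshift N n) l <= 1 by have /andP[] := ct (rshift N l).
  have := sum_weight_value_le_half ut.
  have : 0 <= \sum_l weight_value l ((t ord0 \o @rshift N n) l).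
    by apply: sumr_ge0 => l _; rewrite ltW// weight_value_gt0//; have /andP[] := ct (rshift N l).
  lra.
Qed.

End box_lower_bound.

Theorem theorem3p8 (R : realType) (n : nat) (n_ge1 : (1 <= n)%N) :
  dim_eq (GH_subspace R n) ((n * (n - 1)) %/ 2)%N /\
  dim_eq (box_subspace R n) (((n + 2) * (n - 1)) %/ 2)%N.
Proof.
case: n n_ge1 => [//|n] _; split; first by rewrite -card_opairs; exact: GH_dim_eq.
have -> : (((n.+1 + 2) * (n.+1 - 1)) %/ 2 = #|opairs n.+1| + n)%N.
  (* Writing [n] as [n * 2 %/ 2] reduces the claim to an identity between numerators. *)
  rewrite card_opairs -[X in _ = (_ + X)%N](@mulnK n 2)// -divnDr ?dvdn_mull//.
  by congr (_ %/ 2)%N; rewrite subn1 /=; nia.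
by split; [exact: box_dim_le|exact: box_dim_ge].
Qed.
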